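(* Let $X=(x_{ij})_{1\le i,j\le n}$ be chosen uniformly from the set of $n\times n$ doubly stochastic matrices. Then there exist constants $C>0$ and $c>0$ such that \[ \mathbb{P}\Big(\sum_{2\le i,j\le n}(x_{ij}-x_{i1})^2\ge C\Big)=O\big(\exp(-c\sqrt n)\big) \] as $n\to\infty$.
   Context: A real $n\times n$ matrix is doubly stochastic if its entries are nonnegative and all row and column sums equal $1$. The set of such matrices is identified, via $X\mapsto(x_{ij})_{2\le i,j\le n}$, with a full-dimensional convex body in $\mathbb{R}^{(n-1)^2}$; ''chosen uniformly'' means according to normalized Lebesgue measure on this body. *)

(* Defs.v *)
From HB Require Import structures.
From mathcomp Require Import all_boot all_order all_algebra.
From mathcomp Require Import all_classical all_reals all_analysis.

Set Implicit Arguments.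
Unset Strict Implicit.
Unset Printing Implicit Defensive.

Import Order.TTheory GRing.Theory Num.Theory.
Import numFieldNormedType.Exports.

Local Open Scope classical_set_scope.
Local Open Scope ring_scope.

Section tuple_cons.
Context d (T : measurableType d).

Definition tuple_cons k (p : T * k.-tuple T) : k.+1.-tuple T :=
  [tuple of p.1 :: p.2].

Definition tuple_uncons k (t : k.+1.-tuple T) : T * k.-tuple T :=
  (thead t, [tuple of behead t]).

Lemma tuple_consK k : cancel (@tuple_cons k) (@tuple_uncons k).
Proof.
by move=> [x t]; rewrite /tuple_uncons theadE; congr pair; exact: val_inj.
Qed.

Lemma tuple_unconsK k : cancel (@tuple_uncons k) (@tuple_cons k).
Proof. by move=> t; rewrite [RHS]tuple_eta; exact: val_inj. Qed.

Lemma measurable_tuple_cons k : measurable_fun setT (@tuple_cons k).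
Proof. exact: measurable_cons measurable_fst measurable_snd. Qed.

Lemma measurable_tuple_uncons k : measurable_fun setT (@tuple_uncons k).
Proof.
apply/measurable_fun_pairP; split.
- exact: (measurable_tnth ord0).
- exact: measurable_behead.
Qed.

End tuple_cons.

Section cons_measure.
Context d (T : measurableType d) (R : realType) (k : nat).
Variable mu : {sigma_finite_measure set T -> \bar R}.
Variable nu : {sigma_finite_measure set (k.-tuple T) -> \bar R}.

(* The product of mu and nu, carried over to k.+1.-tuple T. *)
Definition cons_measure : set (k.+1.-tuple T) -> \bar R :=
  pushforward (mu \x nu)%E (@tuple_cons _ T k).

Let measurable_preimage (A : set (k.+1.-tuple T)) :
  measurable A -> measurable (@tuple_cons _ T k @^-1` A).
Proof.
by move=> mA; rewrite -[X in measurable X]setTI; exact: measurable_tuple_cons.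
Qed.

Let cons_measure0 : cons_measure set0 = 0%E.
Proof. by rewrite /cons_measure /pushforward preimage_set0 measure0. Qed.

Let cons_measure_ge0 A : (0 <= cons_measure A)%E.
Proof. by rewrite /cons_measure /pushforward. Qed.

Let cons_measure_sigma_additive : semi_sigma_additive cons_measure.
Proof.
move=> F mF tF mUF; rewrite /cons_measure /pushforward preimage_bigcup.
apply: measure_semi_sigma_additive.
- by move=> n; exact: measurable_preimage.
- apply/trivIsetP => /= i j _ _ ij; rewrite -preimage_setI.
  by move/trivIsetP : tF => /(_ _ _ _ _ ij) ->//; rewrite preimage_set0.
- by rewrite -preimage_bigcup; exact: measurable_preimage.
Qed.

HB.instance Definition _ := isMeasure.Build _ _ _ cons_measure
  cons_measure0 cons_measure_ge0 cons_measure_sigma_additive.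

(* The library's sigma-finite instance on mu \x nu is shadowed by the one for
   subprobabilities, hence the direct proof. *)
Let product_sigma_finite : sigma_finite setT (mu \x nu)%E.
Proof.
have /sigma_finiteP[F [TF ndF Foo]] := sigma_finiteT mu.
have /sigma_finiteP[G [TG ndG Goo]] := sigma_finiteT nu.
exists (fun n => F n `*` G n).
  rewrite -setXTT TF TG predeqE => -[x y]; split.
    move=> [/= [n _ Fnx] [l _ Gly]]; exists (maxn n l) => //; split.
    - by move: x Fnx; exact/subsetPset/ndF/leq_maxl.
    - by move: y Gly; exact/subsetPset/ndG/leq_maxr.
  by move=> [n _ []/= ? ?]; split; exists n.
move=> l; have [? ?] := Foo l; have [? ?] := Goo l.
split; first exact: measurableX.
by rewrite product_measure1E// lte_mul_pinfty// ge0_fin_numE.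
Qed.

Let cons_measure_sigma_finite : sigma_finite setT cons_measure.
Proof.
have [F FT Ffin] := product_sigma_finite.
exists (fun i => @tuple_uncons _ T k @^-1` F i).
  by rewrite -preimage_bigcup -FT preimage_setT.
move=> i; have [mF Foo] := Ffin i; split.
  by rewrite -[X in measurable X]setTI; exact: measurable_tuple_uncons.
rewrite /cons_measure /pushforward -comp_preimage.
rewrite (_ : _ \o _ = id); last by apply/funext => p; exact: tuple_consK.
by rewrite preimage_id.
Qed.

HB.instance Definition _ := Measure_isSigmaFinite.Build _ _ _ cons_measure
  cons_measure_sigma_finite.

End cons_measure.

(* The k-fold product measure mu^k on k.-tuple T. *)
Fixpoint power_measure d (T : measurableType d) (R : realType)
    (mu : {sigma_finite_measure set T -> \bar R}) (k : nat) :
    {sigma_finite_measure set (k.-tuple T) -> \bar R} :=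
  if k is k'.+1 then cons_measure mu (power_measure mu k')
  else dirac [tuple].

Section doubly_stochastic.
Variable R : realType.

Definition doubly_stochastic n : set 'M[R]_n :=
  [set X | [/\ forall i j, 0 <= X i j,
               forall i, \sum_j X i j = 1 &
               forall j, \sum_i X i j = 1]].

(* R^{m^2}, as m x m arrays of reals: the m.-tuple of rows. *)
Definition array m := m.-tuple (m.-tuple (measurableTypeR R)).

Definition lebesgue_array m : {sigma_finite_measure set (array m) -> \bar R} :=
  power_measure (power_measure (@lebesgue_measure R) m) m.

(* X |-> (x_ij)_{2 <= i, j <= n} with n = m.+1; row and column
   ord0 are the ones numbered 1. *)
Definition minor_array m (X : 'M[R]_m.+1) : array m :=
  [tuple [tuple X (lift ord0 i) (lift ord0 j) | j < m] | i < m].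

Definition ds_body m : set (array m) :=
  @minor_array m @` @doubly_stochastic m.+1.

(* The probability that a uniformly chosen doubly stochastic matrix of size
   m.+1 lies in E: the normalized Lebesgue measure of the part of ds_body m
   corresponding to E; @minor_array m is injective on doubly stochastic
   matrices. *)
Definition ds_prob m (E : set 'M[R]_m.+1) : R :=
  fine (@lebesgue_array m (@minor_array m @` (@doubly_stochastic m.+1 `&` E)))
  / fine (@lebesgue_array m (@ds_body m)).

End doubly_stochastic.

(* Main.v *)
(* After rescaling by n = m + 1, one column of a uniform doubly stochastic matrix
   behaves like independent exponential variables, as far as joint upper tails
   are concerned.  Let P(c) be the volume of the part of the polytope where the
   column dominates the threshold vector c.  Brunn--Minkowski gives
   P(c) P(c') <= P((c + c') / 2)^2.  Let c vanish outside a set S of rows with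
   2 |S| <= m.  The rows outside S are exchangeable and the column sum is 1, so
   Markov's inequality shows that raising one more threshold to 64 / n divides P
   by at least 16; by log-concavity, raising it to 64 * 2^l / n divides P by at
   least 16^(2^l).  Hence r given entries all exceed 64 * 2^l / n with probability
   at most 16^(- 2^l r).  A union bound over the sets of r rows, over the levels
   2^l up to about sqrt n, and over the columns shows that, outside an event of
   probability O(n^3 exp (- sqrt n)), each column has a sum of squares O(1 / n),
   and (x - y)^2 <= x^2 + y^2 for nonnegative x and y. *)

Require Import Defs.
From HB Require Import structures.
From mathcomp Require Import all_boot all_order all_algebra.
From mathcomp Require Import all_classical all_reals all_analysis.
From mathcomp Require Import measurable_realfun lebesgue_integral_fubini.
From mathcomp Require Import perm zify ring lra.

Import Order.TTheory GRing.Theory Num.Theory.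
Import numFieldNormedType.Exports.
Import HBNNSimple.

Local Open Scope classical_set_scope.
Local Open Scope ring_scope.

(** * The Prekopa-Leindler inequality *)

Section brunn_minkowski_line.
Context {R : realType}.
Local Notation mu := (@lebesgue_measure R).
Implicit Types A B C : set (measurableTypeR R).

(** The pushforward under the affine map, scaled by [a], gives half-open intervals their length,
    hence is Lebesgue measure by uniqueness. *)
Lemma lebesgue_measure_affine (a b : R) A : 0 < a -> measurable A ->
  mu ((fun x : measurableTypeR R => (a * x + b : measurableTypeR R)) @^-1` A)
  = (a^-1%:E * mu A)%E.
Proof.
move=> a0 mA.
pose phi := fun x : measurableTypeR R => (a * x + b : measurableTypeR R).
have mphi : measurable_fun setT phi.
  by apply: measurable_funD => //; apply: measurable_funM.
pose nu := mscale (NngNum (ltW a0)) (measure_function_pushforward__canonical__measure_function_Measure mu mphi).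
have nuE X : nu X = (a%:E * mu (phi @^-1` X))%E by [].
have -> : mu A = nu A.
  apply: lebesgue_measure_unique => // _ [[u v]] _ <-.
  rewrite -[RHS]/(nu _) nuE.
  have -> : phi @^-1` `]u, v]%classic = `](u - b) / a, (v - b) / a]%classic.
    apply/seteqP; split => x /=; rewrite !in_itv /= /phi.
      by rewrite ltr_pdivrMr// ler_pdivlMr// ltrBlDr lerBrDr mulrC.
    by rewrite ltr_pdivrMr// ler_pdivlMr// ltrBlDr lerBrDr mulrC.
  rewrite !lebesgue_measure_itv /= !lte_fin ltr_pM2r ?invr_gt0// ltrD2r.
  case: ifPn => _; last by rewrite mule0.
  rewrite -!EFinB -EFinM; congr (_%:E).
  by rewrite -mulrBl mulrC divfK ?gt_eqF// opprB addrA subrK.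
by rewrite nuE muleA -EFinM mulVf ?gt_eqF// mul1e.
Qed.

(** Take [a] in [A] near [sup A] and [b] in [B] near [inf B]. The midpoints of [A] with [b] and of
    [B] with [a] lie in [C]; those from points up to [a] fall on the left of [c = (a + b) / 2],
    those from points beyond [b] on its right. What is cut off has measure at most [e / 2] on each
    side. *)
Lemma brunn_minkowski_line A B C (N : R) :
    measurable A -> measurable B -> measurable C -> A !=set0 -> B !=set0 ->
    A `<=` [set` `[- N, N]] -> B `<=` [set` `[- N, N]] ->
    (forall x y, A x -> B y -> C (2^-1 * x + 2^-1 * y)) ->
  (mu A + mu B <= 2%:E * mu C)%E.
Proof.
move=> mA mB mC A0 B0 AN BN ABC.
have supA : has_sup A.
  by split => //; exists N => x /AN /=; rewrite in_itv/= => /andP[].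
have infB : has_inf B.
  by split => //; exists (- N) => x /BN /=; rewrite in_itv/= => /andP[].
apply/lee_addgt0Pr => e e0; have e20 : 0 < e / 2 by rewrite divr_gt0.
have [a Aa supa] := sup_adherent e20 supA.
have [b Bb infb] := inf_adherent e20 infB.
pose c := 2^-1 * a + 2^-1 * b.
pose phi (x : measurableTypeR R) : measurableTypeR R := 2^-1 * x + 2^-1 * b.
pose psi (y : measurableTypeR R) : measurableTypeR R := 2^-1 * y + 2^-1 * a.
have preim (f : measurableTypeR R -> measurableTypeR R) d D :
    f = (fun x : measurableTypeR R => 2^-1 * x + d) -> measurable D ->
    measurable (f @^-1` D).
  move=> -> mD; rewrite -[X in measurable X]setTI.
  by apply: (measurable_funD _ _ _) => //; apply: (measurable_funM _ _ _).
have aff (f : measurableTypeR R -> measurableTypeR R) d D :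
    f = (fun x : measurableTypeR R => 2^-1 * x + d) -> measurable D ->
    mu (f @^-1` D) = (2%:E * mu D)%E.
  by move=> -> mD; rewrite lebesgue_measure_affine// invrK.
have mIl : measurable (C `&` `]-oo, c]%classic) by apply: measurableI.
have mIr : measurable (C `&` `]c, +oo[%classic) by apply: measurableI.
have itvA : (mu `]a, sup A] <= (e / 2)%:E)%E.
  rewrite lebesgue_measure_itv /= lte_fin; case: ifPn => _.
    by rewrite -EFinB lee_fin lerBlDr -lerBlDl ltW.
  by rewrite lee_fin ltW.
have itvB : (mu `[inf B, b] <= (e / 2)%:E)%E.
  rewrite lebesgue_measure_itv /= lte_fin; case: ifPn => _.
    by rewrite -EFinB lee_fin lerBlDl ltW.
  by rewrite lee_fin ltW.
have leA : (mu A <= 2%:E * mu (C `&` `]-oo, c]) + (e / 2)%:E)%E.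
  apply: (@le_trans _ _ (mu (phi @^-1` (C `&` `]-oo, c]%classic) `|` `]a, sup A]%classic))).
    apply: le_measure; rewrite ?inE//.
      by apply: measurableU => //; exact: preim.
    move=> x Ax; have [xa|ax] := leP x a; [left; split|right] => /=.
    - exact: ABC.
    - by rewrite in_itv/= /phi /c lerD2r ler_pM2l.
    - by rewrite in_itv/= ax/=; exact: ub_le_sup supA.2 _ Ax.
  apply: (le_trans (measureU2 mu _ _)) => //; first exact: preim.
  by apply: leeD; [rewrite -(aff phi _ _ erefl mIl)|exact: itvA].
have leB : (mu B <= 2%:E * mu (C `&` `]c, +oo[) + (e / 2)%:E)%E.
  apply: (@le_trans _ _ (mu (psi @^-1` (C `&` `]c, +oo[%classic) `|` `[inf B, b]%classic))).
    apply: le_measure; rewrite ?inE//.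
      by apply: measurableU => //; exact: preim.
    move=> x Bx; have [xb|bx] := leP x b; [right|left; split] => /=.
    - by rewrite in_itv/= xb andbT; exact: ge_inf infB.2 _ Bx.
    - by rewrite /psi addrC; exact: ABC.
    - by rewrite in_itv/= /psi /c addrC ltrD2r ltr_pM2l// bx.
  apply: (le_trans (measureU2 mu _ _)) => //; first exact: preim.
  by apply: leeD; [rewrite -(aff psi _ _ erefl mIr)|exact: itvB].
have CE : mu C = (mu (C `&` `]-oo, c]) + mu (C `&` `]c, +oo[))%E.
  rewrite -measureU//; last first.
    rewrite setIACA setIid; apply/seteqP; split => x //= [_ []].
    by rewrite !in_itv/= andbT => /le_lt_trans/[apply]; rewrite ltxx.
  congr (mu _); apply/seteqP; split => [x Cx|x [] []//].
  by have [xc|cx] := leP x c; [left|right]; split => //=; rewrite in_itv/= ?xc ?cx.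
apply: (le_trans (leeD leA leB)).
by rewrite addeACA -EFinD -splitr CE ge0_muleDr.
Qed.

End brunn_minkowski_line.

(** * The layer-cake formula on the line *)

Section layer_cake.
Context {R : realType}.
Local Notation mu := (@lebesgue_measure R).
Local Notation lineR := (measurableTypeR R).

(** The undergraph of [f / c] cut at height 1. Normalizing by suprema puts the level sets of
    different functions over the common range []0, 1[] of heights, where they are nonempty, as
    Brunn--Minkowski on the line requires. *)
Definition strip_undergraph (f : lineR -> \bar R) (c : R) : set (lineR * lineR) :=
  [set z | 0 < z.2 < 1 /\ ((c * z.2)%:E < f z.1)%E].

Lemma measurable_strip_undergraph f c : measurable_fun setT f ->
  measurable (strip_undergraph f c).
Proof.
move=> mf; rewrite (_ : strip_undergraph f c =
    (snd @^-1` [set` `]0, 1[ ]) `&`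
    (setT `&` [set z : lineR * lineR | ((c * z.2)%:E < f z.1)%E])); last first.
  by apply/seteqP; split => [[x y] [/= y01 cy]|[x y] [/= y01 [_ cy]]]; split=> //;
    rewrite /= ?in_itv//= in y01 *.
apply: measurableI.
  by rewrite -[X in measurable X]setTI; apply: measurable_snd => //; exact: measurable_itv.
apply: measurable_lte => //.
  by apply/measurable_EFinP; apply: measurable_funM.
exact: measurableT_comp.
Qed.

(** Tonelli's theorem: the section above [x] is the interval of heights between 0 and the minimum of
    [f x / c] and 1. *)
Lemma strip_undergraph_integral f (c : R) : 0 < c -> measurable_fun setT f ->
  (forall x, 0 <= f x)%E ->
  (\int[mu]_t mu (ysection (strip_undergraph f c) t) =
   \int[mu]_x mine (c^-1%:E * f x) 1)%E.
Proof.
move=> c0 mf f0; have mE := measurable_strip_undergraph f c mf.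
have := indic_fubini_tonelli mu mu mE.
rewrite (indic_fubini_tonelli_FE mu mE) (indic_fubini_tonelli_GE mu mE) => /esym.
rewrite /comp => ->; apply: eq_integral => x _.
have -> : xsection (strip_undergraph f c) x =
    [set t | 0 < t < 1 /\ ((c * t)%:E < f x)%E].
  by apply/seteqP; split => t; rewrite /xsection/= inE.
have c1 : (0 < c^-1%:E :> \bar R)%E by rewrite lte_fin invr_gt0.
have /orP[fx1|fx1] := le_total (c^-1%:E * f x)%E 1%E.
  have fxfin : f x \is a fin_num.
    rewrite ge0_fin_numE//; case: (f x) fx1 => [r| |//]; first by rewrite ltry.
    by rewrite gt0_muley// leye_eq.
  rewrite min_l//; move: (f0 x) fx1; rewrite -(fineK fxfin) -EFinM !lee_fin.
  set r := fine _ => r0 r1.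
  transitivity (mu `]0, c^-1 * r[).
    congr (mu _); apply/seteqP; split => t /=; rewrite in_itv/= lte_fin.
      by move=> [/andP[-> _] /=]; rewrite ltr_pdivlMl.
    rewrite ltr_pdivlMl// => /andP[t0 tr]; split => //; rewrite t0/=.
    by apply: lt_le_trans r1; rewrite ltr_pdivlMl.
  rewrite lebesgue_measure_itv /= lte_fin; case: ifPn; first by rewrite sube0.
  by rewrite -leNgt => ?; congr (_%:E); apply/eqP; rewrite eq_le ?mulr_ge0// ?invr_ge0 1?ltW// andbT.
rewrite min_r//; transitivity (mu `]0, 1[).
  congr (mu _); apply/seteqP; split => t /=; rewrite in_itv/=; first by case.
  move=> /[dup] t01 /andP[t0 t1]; split => //.
  have : (t%:E < c^-1%:E * f x)%E by apply: lt_le_trans fx1; rewrite lte_fin.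
  by rewrite EFinM -lte_pdivlMl// EFinM.
by rewrite lebesgue_measure_itv /= lte01 sube0.
Qed.

End layer_cake.

(* The midpoint case, squared so that no square root is needed. *)
Definition prekopa_leindler {d} {T : measurableType d} {R : realType}
    (mid : T -> T -> T) (mu : set T -> \bar R) :=
  forall f g h : T -> \bar R,
    measurable_fun setT f -> measurable_fun setT g -> measurable_fun setT h ->
    (forall x, 0 <= f x)%E -> (forall x, 0 <= g x)%E -> (forall x, 0 <= h x)%E ->
    (forall x y, f x * g y <= h (mid x y) * h (mid x y))%E ->
  ((\int[mu]_x f x) * (\int[mu]_x g x) <= (\int[mu]_x h x) * (\int[mu]_x h x))%E.

(** * The Prekopa--Leindler inequality on the line *)

Section prekopa_leindler_line.
Context {R : realType}.
Local Notation mu := (@lebesgue_measure R).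
Local Notation lineR := (measurableTypeR R).

Definition mid_line (x y : lineR) : lineR := 2^-1 * x + 2^-1 * y.

Lemma strip_undergraph_integral_le (f : lineR -> \bar R) (c : R) : 0 < c ->
  measurable_fun setT f -> (forall x, 0 <= f x)%E ->
  (\int[mu]_t mu (ysection (strip_undergraph f c) t) <=
   c^-1%:E * \int[mu]_x f x)%E.
Proof.
move=> c0 mf f0; rewrite strip_undergraph_integral//.
rewrite -ge0_integralZl//; last by rewrite lee_fin invr_ge0 ltW.
have c1 : (0 <= c^-1%:E :> \bar R)%E by rewrite lee_fin invr_ge0 ltW.
have mcf : measurable_fun setT (fun x => c^-1%:E * f x)%E by exact: measurable_funeM.
apply: ge0_le_integral => //.
- by move=> x _; rewrite le_min mule_ge0//=.
- by apply: measurable_mine.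
- by move=> x _; rewrite ge_min lexx.
Qed.

Lemma strip_undergraph_integral_eq (f : lineR -> \bar R) (c : R) : 0 < c ->
  measurable_fun setT f -> (forall x, 0 <= f x <= c%:E)%E ->
  (\int[mu]_t mu (ysection (strip_undergraph f c) t) =
   c^-1%:E * \int[mu]_x f x)%E.
Proof.
move=> c0 mf f0; have f0' x : (0 <= f x)%E by have /andP[] := f0 x.
rewrite strip_undergraph_integral//.
rewrite -ge0_integralZl//; last by rewrite lee_fin invr_ge0 ltW.
apply: eq_integral => x _; rewrite min_l//.
by rewrite lee_pdivrMl// mule1; have /andP[] := f0 x.
Qed.

Lemma ysection_strip_undergraph (f : lineR -> \bar R) (c t : R) :
  ysection (strip_undergraph f c) t = [set x | 0 < t < 1 /\ ((c * t)%:E < f x)%E].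
Proof. by apply/seteqP; split => x; rewrite /ysection /= inE. Qed.

(** Divide [f], [g], [h] by [a], [b] and [s = sqrt (a * b)]. At each height [t] the level sets
    satisfy the one-dimensional Brunn--Minkowski inequality; integrating over [t] gives
    [F / a + G / b <= 2 * (H / s)] for the integrals, and the inequality between arithmetic and
    geometric means turns this into [F * G <= H * H]. *)
Lemma prekopa_leindler_line_bounded (f g h : lineR -> \bar R) (a b N : R) :
    measurable_fun setT f -> measurable_fun setT g -> measurable_fun setT h ->
    0 < a -> 0 < b ->
    (forall x, 0 <= f x <= a%:E)%E -> (forall x, 0 <= g x <= b%:E)%E ->
    (forall x, 0 <= h x)%E ->
    (forall t, t < 1 -> exists x, ((a * t)%:E < f x)%E) ->
    (forall t, t < 1 -> exists x, ((b * t)%:E < g x)%E) ->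
    (forall x, (0 < f x)%E -> [set` `[- N, N]] x) ->
    (forall x, (0 < g x)%E -> [set` `[- N, N]] x) ->
    (forall x y, f x * g y <= h (mid_line x y) * h (mid_line x y))%E ->
  ((\int[mu]_x f x) * (\int[mu]_x g x) <= (\int[mu]_x h x) * (\int[mu]_x h x))%E.
Proof.
move=> mf mg mh a0 b0 fa gb h0 supf supg fN gN fgh.
set s := Num.sqrt (a * b).
have s0 : 0 < s by rewrite sqrtr_gt0 mulr_gt0.
have ss : s * s = a * b by rewrite -expr2 sqr_sqrtr// mulr_ge0// ltW.
have mS u c : measurable_fun setT u ->
    measurable_fun setT (fun t => mu (ysection (strip_undergraph u c) t)).
  by move=> mu'; apply: measurable_fun_ysection; exact: measurable_strip_undergraph.
have myS u c t : measurable_fun setT u -> measurable (ysection (strip_undergraph u c) t).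
  by move=> mu'; apply: measurable_ysection; exact: measurable_strip_undergraph.
have key : (a^-1%:E * \int[mu]_x f x + b^-1%:E * \int[mu]_x g x <=
    2%:E * (s^-1%:E * \int[mu]_x h x))%E.
  rewrite -strip_undergraph_integral_eq// -strip_undergraph_integral_eq//.
  rewrite -ge0_integralD//; [|exact: mS|exact: mS].
  apply: (@le_trans _ _ (2%:E * \int[mu]_t mu (ysection (strip_undergraph h s) t))%E); last first.
    by apply: lee_wpmul2l => //; exact: strip_undergraph_integral_le.
  rewrite -ge0_integralZl//; last exact: mS.
  apply: ge0_le_integral => //.
  - by move=> x _; rewrite adde_ge0.
  - by apply: emeasurable_funD; exact: mS.
  - by apply: measurable_funeM; exact: mS.
  move=> t _; have [/andP[t0 t1]|t01] := boolP (0 < t < 1); last first.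
    rewrite !ysection_strip_undergraph.
    have E u : [set x : lineR | 0 < t < 1 /\ u x] = set0.
      by apply/seteqP; split => x //= -[]; rewrite (negbTE t01).
    by rewrite !E !measure0 adde0 mule0.
  have pos c (u : lineR -> \bar R) x : 0 < c -> ((c * t)%:E < u x -> 0 < u x)%E.
    by move=> c0; apply: lt_trans; rewrite lte_fin mulr_gt0.
  apply: (@brunn_minkowski_line _ _ _ _ N); [exact: myS|exact: myS|exact: myS|..].
  - by have [x fx] := supf _ t1; exists x; rewrite ysection_strip_undergraph/= t0.
  - by have [x gx] := supg _ t1; exists x; rewrite ysection_strip_undergraph/= t0.
  - by move=> x; rewrite ysection_strip_undergraph/= => -[_ /(pos _ _ _ a0)]; exact: fN.
  - by move=> x; rewrite ysection_strip_undergraph/= => -[_ /(pos _ _ _ b0)]; exact: gN.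
  - move=> x y; rewrite !ysection_strip_undergraph/= t0 t1 => -[_ fx] [_ gy]; split => //.
    (* Were [h] at most [s * t] at the midpoint, its square would be at most [(a * t) * (b * t)],
       which [f x * g y] strictly exceeds. *)
    rewrite ltNge; apply/negP => hle.
    have : ((a * t)%:E * (b * t)%:E < f x * g y)%E.
      by apply: lte_pmul => //; rewrite lee_fin mulr_ge0 ?ltW.
    apply/negP; rewrite -leNgt; apply: (le_trans (fgh x y)).
    rewrite -EFinM mulrACA -ss mulrACA EFinM.
    by apply: lee_pmul.
have muN : (mu `[(- N)%R, N] < +oo)%E.
  by rewrite lebesgue_measure_itv/=; case: ifPn => // _; rewrite ltry.
have fin u c : 0 < c -> measurable_fun setT u -> (forall x, 0 <= u x <= c%:E)%E ->
    (forall x, (0 < u x)%E -> [set` `[- N, N]] x) -> (\int[mu]_x u x \is a fin_num)%E.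
  move=> c0 m_u uc uN; have u0 x : (0 <= u x)%E by have /andP[] := uc x.
  rewrite ge0_fin_numE ?integral_ge0//.
  apply: (@le_lt_trans _ _ (\int[mu]_x (c * \1_(`[- N, N]%classic : set lineR) x)%:E)%E).
    apply: ge0_le_integral => //.
    - by apply/measurable_EFinP; apply: measurable_funM.
    - move=> x _; rewrite indicE; case: (boolP (x \in _)) => [_|xN].
        by rewrite mulr1; have /andP[] := uc x.
      rewrite mulr0; have := u0 x; rewrite le_eqVlt => /orP[/eqP <-//|/uN].
      by move/mem_set; rewrite (negbTE xN).
  under eq_integral do rewrite EFinM.
  rewrite ge0_integralZl//; last by rewrite lee_fin ltW.
    by rewrite integral_indic// setIT; apply: lte_mul_pinfty => //; rewrite lee_fin ltW.
  exact/measurable_EFinP.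
have [->|hfin] := eqVneq (\int[mu]_x h x)%E +oo%E; first by rewrite leey.
move: key; have := fin _ _ b0 mg gb gN; have := fin _ _ a0 mf fa fN.
have : (\int[mu]_x h x \is a fin_num)%E by rewrite ge0_fin_numE ?integral_ge0// lt_neqAle hfin leey.
move=> /fineK <- /fineK <- /fineK <-.
rewrite -!EFinM -EFinD !lee_fin.
set F := fine _; set G := fine _; set H := fine _ => le2.
have F0 : 0 <= F by apply/fine_ge0/integral_ge0 => x _; have /andP[] := fa x.
have G0 : 0 <= G by apply/fine_ge0/integral_ge0 => x _; have /andP[] := gb x.
have H0 : 0 <= H by apply/fine_ge0/integral_ge0.
have -> : F * G = a * b * (a^-1 * F * (b^-1 * G)) by field; rewrite !gt_eqF.
have -> : H * H = a * b * (s^-1 * H * (s^-1 * H)) by rewrite -ss; field; rewrite !gt_eqF.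
rewrite ler_pM2l ?mulr_gt0//.
move: le2; set x := a^-1 * F; set y := b^-1 * G; set z := s^-1 * H => le2.
have x0 : 0 <= x by rewrite mulr_ge0// invr_ge0 ltW.
have y0 : 0 <= y by rewrite mulr_ge0// invr_ge0 ltW.
have : 0 <= (x - y) ^+ 2 by rewrite sqr_ge0.
have : (x + y) ^+ 2 <= (2 * z) ^+ 2 by apply: lerXn2r; rewrite ?nnegrE ?addr_ge0// (le_trans _ le2)// addr_ge0.
by nra.
Qed.

(** The witness is the supremum of [f], the normalization under which every level [t < 1] is
    reached. It must be positive to divide by it, hence the separate case of a vanishing [f]. *)
Lemma ereal_sup_range_approx (f : lineR -> \bar R) (c : R) :
    (forall x, 0 <= f x <= c%:E)%E -> (forall x, f x = 0%E) \/
  exists a : R, [/\ 0 < a, (forall x, 0 <= f x <= a%:E)%E &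
    forall t, t < 1 -> exists x, ((a * t)%:E < f x)%E].
Proof.
move=> fc; pose a := ereal_sup (range f).
have fa x : (f x <= a)%E by apply: ereal_sup_ubound; exists x.
have ac : (a <= c%:E)%E by apply: ge_ereal_sup => _ [x _ <-]; have /andP[] := fc x.
have a0 : (0 <= a)%E by apply: le_trans (fa 0); have /andP[] := fc 0.
have [aE|aneq0] := eqVneq a 0%E.
  by left => x; apply/eqP; rewrite eq_le -{1}aE fa/=; have /andP[] := fc x.
right; have afin : a \is a fin_num by rewrite ge0_fin_numE// (le_lt_trans ac)// ltry.
have fa0 : 0 < fine a by apply: fine_gt0; rewrite lt0e aneq0 a0 (le_lt_trans ac)// ltry.
exists (fine a); split => //.
  by move=> x; rewrite fineK// fa andbT; have /andP[] := fc x.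
move=> t t1; have : ((fine a * t)%:E < a)%E.
  by rewrite -{2}(fineK afin) lte_fin gtr_pMr.
by move=> /ereal_sup_gt[_ [x _ <-]] ltx; exists x.
Qed.

(** [f] and [g] are replaced by simple functions cut off to [[- n, n]] that increase to them;
    lowering [f] and [g] preserves the hypothesis, so [h] is kept. Monotone convergence
    concludes. *)
Lemma prekopa_leindler_line : prekopa_leindler mid_line mu.
Proof.
move=> f g h mf mg mh f0 g0 h0 fgh.
(* Zero integrals are settled first so that the product of the limits is never the undefined form
   [0 * +oo]. *)
have [->|int_f0] := eqVneq (\int[mu]_x f x)%E 0%E; first by rewrite mul0e mule_ge0 ?integral_ge0.
have [->|int_g0] := eqVneq (\int[mu]_x g x)%E 0%E; first by rewrite mule0 mule_ge0 ?integral_ge0.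
pose J n : set lineR := [set` `[- n%:R, n%:R]].
pose trunc u (mu_ : measurable_fun setT u) n x : \bar R :=
  (nnsfun_approx measurableT mu_ n x * \1_(J n) x)%:E.
have mtrunc u m_u n : measurable_fun setT (trunc u m_u n).
  apply/measurable_EFinP; apply: measurable_funM; first exact: measurable_funP.
  by apply: measurable_indic; exact: measurable_itv.
have trunc0 u m_u n x : (0 <= trunc u m_u n x)%E by rewrite lee_fin mulr_ge0.
have ndtrunc u m_u x : {homo (trunc u m_u ^~ x) : n m / (n <= m)%N >-> (n <= m)%E}.
  move=> n m nm; rewrite lee_fin ler_pM//; first exact/lefP/nd_nnsfun_approx.
  rewrite !indicE; have [xn|//] := boolP (x \in J n).
  rewrite mem_set//; move: xn; rewrite inE /J/= !in_itv/= => /andP[nx xn].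
  have nmR : n%:R <= m%:R :> R by rewrite ler_nat.
  by rewrite (le_trans _ nx) ?lerN2// (le_trans xn).
have cvtrunc u m_u : (forall x, 0 <= u x)%E -> forall x, trunc u m_u ^~ x @ \oo --> u x.
  move=> u0 x; apply: cvg_trans; last exact: (@cvg_nnsfun_approx _ _ _ _ measurableT _ m_u (fun x _ => u0 x) x I).
  apply: near_eq_cvg; near=> n; rewrite /= /trunc indicE mem_set ?mulr1//.
  by rewrite /J/= in_itv/= -ler_norml; near: n; exact: nbhs_infty_ger.
have tr_le u m_u n x : (forall x, 0 <= u x)%E -> (trunc u m_u n x <= u x)%E.
  move=> u0; apply: (@le_trans _ _ (nnsfun_approx measurableT m_u n x)%:E).
    by rewrite lee_fin ler_piMr// indicE; case: (_ \in _).
  by rewrite nnsfun_approxE; exact: le_approx.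
have inttrunc u m_u : (forall x, 0 <= u x)%E ->
    (\int[mu]_x trunc u m_u n x)%E @[n --> \oo] --> (\int[mu]_x u x)%E.
  move=> u0.
  rewrite (_ : (\int[mu]_x u x)%E = (\int[mu]_x limn (trunc u m_u ^~ x))%E); last first.
    by apply: eq_integral => x _; apply/esym/cvg_lim => //; exact: cvtrunc.
  by apply: cvg_monotone_convergence => // x _; exact: ndtrunc.
have bnd u m_u n : exists c : R, (forall x, 0 <= trunc u m_u n x <= c%:E)%E.
  have [c [_ cP]] := @simple_bounded _ _ _ (nnsfun_approx measurableT m_u n).
  exists (c + 1) => x; rewrite trunc0 lee_fin/=.
  have := cP (c + 1); rewrite ltrDl ltr01 => /(_ isT x I).
  move=> /= le1; apply: le_trans (le_trans (ler_norm _) le1).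
  by rewrite ler_piMr// indicE; case: (_ \in _).
have sup u m_u n x : (0 < trunc u m_u n x)%E -> [set` `[- n%:R, n%:R]] x.
  rewrite lte_fin indicE; case: (boolP (_ \in _)); first by rewrite inE.
  by rewrite mulr0 ltxx.
have step n : ((\int[mu]_x trunc f mf n x) * (\int[mu]_x trunc g mg n x) <=
   (\int[mu]_x h x) * (\int[mu]_x h x))%E.
  have hh0 : (0 <= (\int[mu]_x h x) * (\int[mu]_x h x))%E by rewrite mule_ge0 ?integral_ge0.
  have [c fc] := bnd f mf n; have [c' gc] := bnd g mg n.
  have [fE|[a [a0 fa supf]]] := ereal_sup_range_approx _ _ fc.
    by rewrite integral0_eq ?mul0e.
  have [gE|[b [b0 gb supg]]] := ereal_sup_range_approx _ _ gc.
    by rewrite [X in (_ * X)%E]integral0_eq ?mule0.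
  apply: (prekopa_leindler_line_bounded _ _ _ a b n%:R) => //; [exact: sup|exact: sup|].
  by move=> x y; apply: le_trans (fgh x y); apply: lee_pmul => //; apply: tr_le.
have cv : ((\int[mu]_x trunc f mf n x) * (\int[mu]_x trunc g mg n x))%E @[n --> \oo] -->
    ((\int[mu]_x f x) * (\int[mu]_x g x))%E.
  apply: cvgeM; [|exact: inttrunc|exact: inttrunc].
  by rewrite mule_defE (negbTE int_f0) (negbTE int_g0).
rewrite -(cvg_lim _ cv)//; apply: lime_le; first by apply/cvg_ex; exists (\int[mu]_x f x * \int[mu]_x g x)%E.
by near=> n; exact: step.
Unshelve. all: by end_near.
Qed.
End prekopa_leindler_line.

(** * Tensorization of the Prekopa--Leindler inequality *)

Section prekopa_leindler_power.
Context d (T : measurableType d) (R : realType) (mid : T -> T -> T).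

Definition mid_tuple k (s t : k.-tuple T) : k.-tuple T :=
  [tuple mid (tnth s i) (tnth t i) | i < k].

Lemma mid_tuple_cons k (p q : T * k.-tuple T) :
  mid_tuple k.+1 (tuple_cons p) (tuple_cons q) =
  tuple_cons (mid p.1 q.1, mid_tuple k p.2 q.2).
Proof.
apply: eq_from_tnth => i; rewrite tnth_mktuple.
have [->|i0] := eqVneq i ord0; first by rewrite /tuple_cons !tnth0.
have [j ->] : exists j, i = lift ord0 j by case: (unliftP ord0 i) i0 => [j ->|->]; [exists j|rewrite eqxx].
by rewrite /tuple_cons !tnthS tnth_mktuple.
Qed.

Lemma ge0_integral_cons_measure k (mu : {sigma_finite_measure set T -> \bar R})
    (nu : {sigma_finite_measure set (k.-tuple T) -> \bar R})
    (f : k.+1.-tuple T -> \bar R) :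
  measurable_fun setT f -> (forall x, 0 <= f x)%E ->
  (\int[cons_measure mu nu]_t f t =
   \int[mu]_x \int[nu]_s f (tuple_cons (x, s)))%E.
Proof.
move=> mf f0; have mc := @measurable_tuple_cons _ T k.
transitivity (\int[pushforward (mu \x nu)%E (@tuple_cons _ T k)]_t f t)%E => //.
rewrite ge0_integral_pushforward// preimage_setT.
rewrite (@fubini_tonelli1 _ _ _ _ _ mu nu (f \o @tuple_cons _ T k))//.
  exact: (measurableT_comp mf mc).
by move=> x; exact: f0.
Qed.

(** For fixed first coordinates the hypothesis holds on the fibres, so the inequality for [nu] shows
    that the fibre integrals satisfy the hypothesis of the inequality for [mu]. *)
Lemma prekopa_leindler_cons k (mu : {sigma_finite_measure set T -> \bar R})
    (nu : {sigma_finite_measure set (k.-tuple T) -> \bar R}) :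
  prekopa_leindler mid mu -> prekopa_leindler (mid_tuple k) nu ->
  prekopa_leindler (mid_tuple k.+1) (cons_measure mu nu).
Proof.
move=> PLmu PLnu f g h mf mg mh f0 g0 h0 fgh.
rewrite !ge0_integral_cons_measure//.
have mc := @measurable_tuple_cons _ T k.
have mcomp (u : k.+1.-tuple T -> \bar R) : measurable_fun setT u ->
    measurable_fun setT (u \o @tuple_cons _ T k) by move=> m_u; exact: (measurableT_comp m_u mc).
have mF (u : k.+1.-tuple T -> \bar R) : measurable_fun setT u -> (forall x, 0 <= u x)%E ->
    measurable_fun setT (fun x => \int[nu]_s u (tuple_cons (x, s)))%E.
  move=> m_u u0.
  apply: (@measurable_fun_fubini_tonelli_F _ _ _ _ _ nu (u \o @tuple_cons _ T k)).
    exact: mcomp.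
  by move=> x; exact: u0.
have msec (u : k.+1.-tuple T -> \bar R) x : measurable_fun setT u ->
    measurable_fun setT (fun s => u (tuple_cons (x, s))).
  move=> m_u; apply: (measurableT_comp (mcomp u m_u)); exact: pair1_measurable.
apply: PLmu; [exact: mF|exact: mF|exact: mF|..].
- by move=> x; exact: integral_ge0.
- by move=> x; exact: integral_ge0.
- by move=> x; exact: integral_ge0.
move=> x y; apply: PLnu; [exact: msec|exact: msec|exact: msec|by []|by []|by []|].
by move=> s t; have := fgh (tuple_cons (x, s)) (tuple_cons (y, t)); rewrite mid_tuple_cons.
Qed.

Lemma prekopa_leindler_power (mu : {sigma_finite_measure set T -> \bar R}) k :
  prekopa_leindler mid mu -> prekopa_leindler (mid_tuple k) (power_measure mu k).
Proof.
move=> PLmu; elim: k => [|k IHk]; last exact: prekopa_leindler_cons.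
move=> f g h mf mg mh f0 g0 h0 fgh /=.
rewrite !integral_dirac// !diracT !mul1e.
by have := fgh [tuple] [tuple]; rewrite [mid_tuple 0 _ _]tuple0.
Qed.

End prekopa_leindler_power.

Arguments mid_tuple {d T} mid {k}.

Definition mid_array {R : realType} {m} : array R m -> array R m -> array R m :=
  mid_tuple (mid_tuple mid_line).

Lemma prekopa_leindler_lebesgue_array (R : realType) m :
  prekopa_leindler (@mid_array R m) (lebesgue_array R m).
Proof. by do 2 apply: prekopa_leindler_power; exact: prekopa_leindler_line. Qed.

(** Prekopa--Leindler for indicator functions. *)
Lemma brunn_minkowski (R : realType) m (A B C : set (array R m)) :
    measurable A -> measurable B -> measurable C ->
    (forall x y, A x -> B y -> C (mid_array x y)) ->
  (lebesgue_array R m A * lebesgue_array R m B <=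
   lebesgue_array R m C * lebesgue_array R m C)%E.
Proof.
move=> mA mB mC ABC.
have := prekopa_leindler_lebesgue_array R m (EFin \o \1_A) (EFin \o \1_B) (EFin \o \1_C).
rewrite !integral_indic// !setIT; apply.
- by apply/measurable_EFinP.
- by apply/measurable_EFinP.
- by apply/measurable_EFinP.
- by move=> x; rewrite lee_fin.
- by move=> x; rewrite lee_fin.
- by move=> x; rewrite lee_fin.
move=> x y /=; rewrite -!EFinM lee_fin !indicE.
have [/[!inE] xA|_] := boolP (x \in A); last by rewrite mul0r mulr_ge0.
have [/[!inE] yB|_] := boolP (y \in B); last by rewrite mulr0 mulr_ge0.
by rewrite (mem_set (ABC _ _ xA yB)).
Qed.

(** * Invariance of product measures under permutations of coordinates *)

Section power_measure_box.
Context d (T : measurableType d) (R : realType).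
Variable mu : {sigma_finite_measure set T -> \bar R}.

Definition box k (A : 'I_k -> set T) : set (k.-tuple T) :=
  [set t | forall i, A i (tnth t i)].

Lemma measurable_box k (A : 'I_k -> set T) :
  (forall i, measurable (A i)) -> measurable (box k A).
Proof.
move=> mA; rewrite (_ : box k A = \bigcap_(i in [set: 'I_k]) ((fun t => tnth t i) @^-1` A i)).
  apply: fin_bigcap_measurable => // i _; rewrite -[X in measurable X]setTI.
  exact: measurable_tnth.
by apply/seteqP; split => [t At i _|t At i]; [exact: At|exact: (At i)].
Qed.

Lemma power_measure_box k (A : 'I_k -> set T) :
  (forall i, measurable (A i)) ->
  power_measure mu k (box k A) = (\prod_(i < k) mu (A i))%E.
Proof.
elim: k A => [|k IHk] A mA.
  by rewrite big_ord0 /= diracE mem_set// => -[].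
rewrite big_ord_recl -(IHk (fun i => A (lift ord0 i)))//.
rewrite -product_measure1E//; last exact: measurable_box.
congr ((mu \x _)%E _); apply/seteqP; split => [[x s] /= As|[x s] [/= Ax As] i].
  split => [|i] /=; first by have := As ord0; rewrite /tuple_cons tnth0.
  by have := As (lift ord0 i); rewrite /tuple_cons tnthS.
by case: (unliftP ord0 i) => [j ->|->]; rewrite /tuple_cons ?tnthS ?tnth0//; exact: As.
Qed.

Definition tuple_reindex k (s : 'I_k -> 'I_k) (t : k.-tuple T) : k.-tuple T :=
  [tuple tnth t (s i) | i < k].

Lemma measurable_tuple_reindex k (s : 'I_k -> 'I_k) : measurable_fun setT (tuple_reindex k s).
Proof.
apply/measurable_fun_tnthP => i.
rewrite (_ : _ \o _ = fun t => tnth t (s i)); first exact: measurable_tnth.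
by apply/funext => t /=; rewrite tnth_mktuple.
Qed.

(** Boxes form a generating class closed under intersection, and a permutation only reorders the
    factors in the measure of a box; sigma-finiteness then gives uniqueness. *)
Lemma power_measure_reindex k (s s' : 'I_k -> 'I_k) (A : set (k.-tuple T)) :
  cancel s s' -> cancel s' s -> measurable A ->
  power_measure mu k (tuple_reindex k s @^-1` A) = power_measure mu k A.
Proof.
move=> sK s'K mA; have ms := measurable_tuple_reindex k s.
pose nu := measure_function_pushforward__canonical__measure_function_Measure (power_measure mu k) ms.
have [F [FT ndF Ffin]] := (sigma_finiteP _ _).1 (sigma_finiteT mu).
apply/esym; rewrite -[RHS]/(nu A).
pose G : set (set (k.-tuple T)) :=
  [set B | exists2 C : 'I_k -> set T, (forall i, measurable (C i)) & B = box k C].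
have GI : setI_closed G.
  move=> _ _ [C mC ->] [D mD ->]; exists (fun i => C i `&` D i).
    by move=> i; exact: measurableI.
  apply/seteqP; split => [t [Ct Dt] i|t CDt]; first by split; [exact: Ct|exact: Dt].
  by split => i; have [] := CDt i.
apply: (measure_unique G (fun n => box k (fun=> F n))) => //.
- apply/seteqP; split.
    apply: smallest_sub; first exact: smallest_sigma_algebra.
    move=> B; rewrite -bigcup_seq => -[/= i _ [C mC <-]].
    apply: sub_sigma_algebra; exists (fun j => if j == i then C else setT).
      by move=> j; case: ifP.
    rewrite setTI; apply/seteqP; split => [t /= Ct j|t /(_ i)].
      by case: eqP => // ->.
    by rewrite eqxx.
  apply: smallest_sub; first exact: sigma_algebra_measurable.
  by move=> _ [C mC ->]; exact: measurable_box.
- by move=> n; exists (fun=> F n) => // _; have [] := Ffin n.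
- apply/seteqP; split => // t _.
  have Ft i : exists n, F n (tnth t i).
    have : [set: T] (tnth t i) by [].
    by rewrite FT => -[n _ Fn]; exists n.
  have [N tN] := choice Ft.
  exists (\max_i N i) => // i.
  by move: (tN i); apply/subsetPset/ndF/leq_bigmax.
- move=> _ [C mC ->]; rewrite [RHS](_ : _ = power_measure mu k (box k (fun i => C (s' i)))).
    transitivity (\prod_(i < k) mu (C i))%E; first exact: power_measure_box.
    by rewrite power_measure_box// (reindex_inj (can_inj s'K)).
  rewrite -[LHS]/(power_measure mu k (tuple_reindex k s @^-1` box k C)).
  congr (_ _); apply/seteqP; split => t /= Ct i.
    by have := Ct (s' i); rewrite tnth_mktuple s'K.
  by rewrite tnth_mktuple; have := Ct (s i); rewrite sK.
- move=> n; have mFn : forall i : 'I_k, measurable (F n) by have [] := Ffin n.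
  suff : (\prod_(i < k) mu (F n) < +oo)%E by rewrite -(power_measure_box k (fun=> F n)).
  have Fnfin : mu (F n) \is a fin_num by rewrite ge0_fin_numE//; have [] := Ffin n.
  by rewrite -(fineK Fnfin) prodEFin ltry.
Qed.

End power_measure_box.
Arguments tuple_reindex {d T k}.
Arguments box {d T k}.

(** * Coordinates on the set of doubly stochastic matrices *)

Section complete_array.
Context {R : realType} {m : nat}.
Implicit Types t s : array R m.

(* The matrix with all row and column sums 1 whose minor is t. *)
Definition complete t : 'M[R]_m.+1 := \matrix_(i, j)
  match unlift ord0 i, unlift ord0 j with
  | Some i', Some j' => tnth (tnth t i') j'
  | Some i', None => 1 - \sum_l tnth (tnth t i') l
  | None, Some j' => 1 - \sum_k tnth (tnth t k) j'
  | None, None => 1 - \sum_l (1 - \sum_k tnth (tnth t k) l)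
  end.

Lemma complete_lift t i j :
  complete t (lift ord0 i) (lift ord0 j) = tnth (tnth t i) j.
Proof. by rewrite mxE !liftK. Qed.

Lemma complete_lift0 t i :
  complete t (lift ord0 i) ord0 = 1 - \sum_l tnth (tnth t i) l.
Proof. by rewrite mxE liftK unlift_none. Qed.

Lemma complete_0lift t j :
  complete t ord0 (lift ord0 j) = 1 - \sum_k tnth (tnth t k) j.
Proof. by rewrite mxE liftK unlift_none. Qed.

Lemma complete_00 t :
  complete t ord0 ord0 = 1 - \sum_l (1 - \sum_k tnth (tnth t k) l).
Proof. by rewrite mxE unlift_none. Qed.

Lemma complete_row_sum t i : \sum_j complete t i j = 1.
Proof.
rewrite big_ord_recl; case: (unliftP ord0 i) => [k ->|->].
  by rewrite complete_lift0; under [X in _ + X]eq_bigr do rewrite complete_lift; rewrite subrK.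
by rewrite complete_00; under [X in _ + X]eq_bigr do rewrite complete_0lift; rewrite subrK.
Qed.

(** The corner entry is defined so that row [ord0] sums to 1; column [ord0] does too because summing
    the minor by rows or by columns gives the same total. *)
Lemma complete_col_sum t j : \sum_i complete t i j = 1.
Proof.
rewrite big_ord_recl; case: (unliftP ord0 j) => [k ->|->].
  by rewrite complete_0lift; under [X in _ + X]eq_bigr do rewrite complete_lift; rewrite subrK.
rewrite complete_00; under [X in _ + X]eq_bigr do rewrite complete_lift0.
by rewrite !sumrB exchange_big/=; ring.
Qed.

Lemma minor_complete t : minor_array (complete t) = t.
Proof.
apply: eq_from_tnth => i; apply: eq_from_tnth => j.
by rewrite !tnth_mktuple complete_lift.
Qed.

Lemma complete_minor (X : 'M[R]_m.+1) : doubly_stochastic X ->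
  complete (minor_array X) = X.
Proof.
move=> [_ rX cX].
have tE i j : tnth (tnth (minor_array X) i) j = X (lift ord0 i) (lift ord0 j).
  by rewrite !tnth_mktuple.
have r0 i : 1 - \sum_l X i (lift ord0 l) = X i ord0.
  by rewrite -(rX i) big_ord_recl addrK.
have c0 j : 1 - \sum_k X (lift ord0 k) j = X ord0 j.
  by rewrite -(cX j) big_ord_recl addrK.
apply/matrixP => i j; case: (unliftP ord0 i) => [i' ->|->];
  case: (unliftP ord0 j) => [j' ->|->].
- by rewrite complete_lift tE.
- by rewrite complete_lift0; under eq_bigr do rewrite tE; rewrite r0.
- by rewrite complete_0lift; under eq_bigr do rewrite tE; rewrite c0.
- rewrite complete_00; under eq_bigr do under eq_bigr do rewrite tE.
  by under eq_bigr do rewrite c0; rewrite r0.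
Qed.

Lemma doubly_stochastic_complete t :
  doubly_stochastic (complete t) <-> forall i j, 0 <= complete t i j.
Proof.
split=> [[]//|ct]; split => //; [exact: complete_row_sum|exact: complete_col_sum].
Qed.

(** Since [complete] inverts the minor map on doubly stochastic matrices, images become sets defined
    by conditions on the entries of [complete t], which are measurable functions of [t]. *)
Lemma image_minor_array (E : set 'M[R]_m.+1) :
  @minor_array R m @` (@doubly_stochastic R m.+1 `&` E) =
  [set t | (forall i j, 0 <= complete t i j) /\ E (complete t)].
Proof.
apply/seteqP; split => [_ [X [dX EX] <-]|t [ct Et]] /=.
  by rewrite complete_minor//; split => //; case: dX.
exists (complete t); last exact: minor_complete.
by split => //; exact/doubly_stochastic_complete.
Qed.

Lemma ds_bodyE : @ds_body R m = [set t | forall i j, 0 <= complete t i j].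
Proof.
rewrite /ds_body -[X in _ @` X]setIT image_minor_array.
by apply/seteqP; split => [t []|t ct].
Qed.

(** Each entry of [complete] is affine in the minor. This is how convexity enters
    Brunn--Minkowski. *)
Lemma complete_mid_array s t i j :
  complete (mid_array s t) i j = 2^-1 * complete s i j + 2^-1 * complete t i j.
Proof.
have E k l : tnth (tnth (mid_array s t) k) l =
    2^-1 * tnth (tnth s k) l + 2^-1 * tnth (tnth t k) l by rewrite !tnth_mktuple.
have aff (f g : 'I_m -> R) : 1 - \sum_k (2^-1 * f k + 2^-1 * g k) =
    2^-1 * (1 - \sum_k f k) + 2^-1 * (1 - \sum_k g k).
  by rewrite big_split/= -!mulr_sumr; field.
case: (unliftP ord0 i) => [i' ->|->]; case: (unliftP ord0 j) => [j' ->|->].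
- by rewrite !complete_lift E.
- by rewrite !complete_lift0; under eq_bigr do rewrite E; rewrite aff.
- by rewrite !complete_0lift; under eq_bigr do rewrite E; rewrite aff.
- rewrite !complete_00; under eq_bigr do under eq_bigr do rewrite E.
  by under eq_bigr do rewrite aff; rewrite aff.
Qed.

Lemma measurable_complete i j : measurable_fun setT (fun t => complete t i j).
Proof.
have mt k l : measurable_fun setT (fun t => tnth (tnth t k) l : R).
  exact: (measurableT_comp (measurable_tnth l) (measurable_tnth k)).
case: (unliftP ord0 i) => [i' ->|->]; case: (unliftP ord0 j) => [j' ->|->].
- under eq_fun do rewrite complete_lift; exact: mt.
- under eq_fun do rewrite complete_lift0.
  by apply: measurable_funB => //; exact: measurable_sum.
- under eq_fun do rewrite complete_0lift.
  by apply: measurable_funB => //; exact: measurable_sum.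
- under eq_fun do rewrite complete_00.
  apply: measurable_funB => //; apply: measurable_sum => l.
  by apply: measurable_funB => //; exact: measurable_sum.
Qed.

Lemma complete_reindex_lift (f : 'I_m -> 'I_m) t i j :
  complete (tuple_reindex f t) (lift ord0 i) j = complete t (lift ord0 (f i)) j.
Proof.
case: (unliftP ord0 j) => [j' ->|->].
  by rewrite !complete_lift tnth_mktuple.
by rewrite !complete_lift0 tnth_mktuple.
Qed.

(** Row [ord0] depends only on the column sums of the minor, which a permutation of its rows
    preserves. *)
Lemma complete_reindex0 (f : 'I_m -> 'I_m) t j : injective f ->
  complete (tuple_reindex f t) ord0 j = complete t ord0 j.
Proof.
move=> finj.
have E l : \sum_k tnth (tnth (tuple_reindex f t) k) l = \sum_k tnth (tnth t k) l.
  rewrite [RHS](reindex_inj finj)/=; apply: eq_bigr => k _.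
  by rewrite tnth_mktuple.
case: (unliftP ord0 j) => [j' ->|->]; first by rewrite !complete_0lift E.
by rewrite !complete_00; under eq_bigr do rewrite E.
Qed.

End complete_array.

(** * Joint tails of the entries of a column *)

Lemma measurable_forall d (T : measurableType d) (I : finType) (A : I -> set T) :
  (forall i, measurable (A i)) -> measurable [set t | forall i, A i t].
Proof.
move=> mA; rewrite (_ : mkset _ = \bigcap_(i in [set: I]) A i).
  exact: fin_bigcap_measurable.
by apply/seteqP; split => [t At i _|t At i]; [exact: At|exact: (At i)].
Qed.

(** Obtained by integrating the pointwise bound on indicators; it is the measure-theoretic half of
    Markov's inequality in [level_mass_markov]. *)
Lemma sum_measure_le d (T : measurableType d) (R : realType) (I : finType)
    (mu : {measure set T -> \bar R}) (K : pred I) (A : I -> set T) (B : set T) (r : R) :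
    (forall i, measurable (A i)) -> measurable B -> 0 <= r ->
    (forall t, \sum_(i | K i) \1_(A i) t <= r * \1_B t) ->
  (\sum_(i | K i) mu (A i) <= r%:E * mu B)%E.
Proof.
move=> mA mB r0 AB.
rewrite -[X in (_ * mu X)%E]setIT -integral_indic//.
rewrite -ge0_integralZl//; last exact/measurable_EFinP.
under eq_bigr do rewrite -[X in mu X]setIT -integral_indic//.
rewrite -big_filter -ge0_integral_sum//; last first.
  by move=> i; exact/measurable_EFinP.
apply: ge0_le_integral => //.
- by move=> t _; apply: sume_ge0.
- by apply: emeasurable_sum => i; exact/measurable_EFinP.
- by apply/measurable_EFinP; apply: measurable_funM.
- by move=> t _; rewrite sumEFin big_filter -EFinM lee_fin AB.
Qed.

Section column_levels.
Context {R : realType} {m : nat} (j : 'I_m.+1).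
Local Notation mu := (lebesgue_array R m).
Implicit Types (t : array R m) (c : 'I_m -> R).

(** Thresholds concern only the rows other than [ord0], those that permutations of the rows of the
    minor exchange. A threshold at most 0 imposes nothing. *)
Definition column_level c : set (array R m) :=
  [set t | (forall i k, 0 <= complete t i k) /\
           (forall i, c i <= complete t (lift ord0 i) j)].

Definition level_mass c : R := fine (mu (column_level c)).

Lemma measurable_complete_ge (a : R) (i k : 'I_m.+1) :
  measurable [set t : array R m | a <= complete t i k].
Proof.
rewrite (_ : mkset _ = setT `&` (fun t => complete t i k) @^-1` `[a, +oo[%classic).
  by apply: measurable_complete => //; exact: measurable_itv.
by rewrite setTI; apply/seteqP; split => t /=; rewrite in_itv/= andbT.
Qed.

Lemma measurable_ds_body : measurable (@ds_body R m).
Proof.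
rewrite ds_bodyE; apply: measurable_forall => i; apply: measurable_forall => k.
exact: measurable_complete_ge.
Qed.

Lemma measurable_column_level c : measurable (column_level c).
Proof.
rewrite (_ : column_level c = @ds_body R m `&`
    [set t | forall i, c i <= complete t (lift ord0 i) j]); last by rewrite ds_bodyE.
apply: measurableI; first exact: measurable_ds_body.
by apply: measurable_forall => i; exact: measurable_complete_ge.
Qed.

Lemma complete_le1 t i k : (forall i k, 0 <= complete t i k) -> complete t i k <= 1.
Proof.
move=> ct; rewrite -(complete_row_sum t i) (bigD1 k)//= lerDl.
by apply: sumr_ge0 => l _; exact: ct.
Qed.

(** The body lies in the unit cube because the entries are at most 1. Finiteness is what makes
    [fine] faithful in [level_mass]. *)
Lemma lebesgue_ds_body_fin : (mu (@ds_body R m) < +oo)%E.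
Proof.
pose Q1 : set (m.-tuple (measurableTypeR R)) := 
    box (fun=> `[0%R, 1%R]%classic : set (measurableTypeR R)).
pose Q : set (array R m) := box (fun=> Q1).
have mQ1 : measurable Q1.
  by apply: measurable_box => _; exact: measurable_itv.
apply: (@le_lt_trans _ _ (mu Q)).
  apply: le_measure; rewrite ?inE.
  - exact: measurable_ds_body.
  - exact: measurable_box.
  - rewrite ds_bodyE => t /= ct i k /=; rewrite in_itv/= -complete_lift.
    by rewrite ct complete_le1.
have itv1 : (@lebesgue_measure R `[0%R, 1%R] = 1)%E.
  by rewrite lebesgue_measure_itv/= lte_fin ltr01 oppr0 adde0.
have Q1E : power_measure (@lebesgue_measure R) m Q1 = 1%E.
  rewrite power_measure_box; first by rewrite big1.
  by move=> _; exact: measurable_itv.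
by rewrite power_measure_box// big1 ?ltry.
Qed.

Lemma column_level_fin c : (mu (column_level c) < +oo)%E.
Proof.
apply: le_lt_trans lebesgue_ds_body_fin; apply: le_measure; rewrite ?inE.
- exact: measurable_column_level.
- exact: measurable_ds_body.
- by rewrite ds_bodyE => t [].
Qed.

Lemma level_massE c : mu (column_level c) = (level_mass c)%:E.
Proof. by rewrite fineK// ge0_fin_numE// column_level_fin. Qed.

Lemma level_mass_ge0 c : 0 <= level_mass c.
Proof. exact: fine_ge0. Qed.

Lemma level_mass_le c c' : (forall i, c i <= c' i) -> level_mass c' <= level_mass c.
Proof.
move=> cc'; rewrite -lee_fin -!level_massE; apply: le_measure; rewrite ?inE.
- exact: measurable_column_level.
- exact: measurable_column_level.
- by move=> t [t0 ct]; split => // i; apply: le_trans (cc' i) (ct i).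
Qed.

Lemma level_mass_nonpos c : (forall i, c i <= 0) ->
  level_mass c = fine (mu (@ds_body R m)).
Proof.
move=> c0; congr (fine (mu _)); rewrite ds_bodyE.
by apply/seteqP; split => [t []//|t ct]; split => // i; exact: le_trans (c0 i) (ct _ _).
Qed.

(** Midpoints between the sets for [c] and [c'] lie in the set for [c''], as [complete] is affine;
    Brunn--Minkowski does the rest. *)
Lemma level_mass_log_concave c c' c'' :
  (forall i, c'' i = 2^-1 * c i + 2^-1 * c' i) ->
  level_mass c * level_mass c' <= level_mass c'' ^+ 2.
Proof.
move=> mid; rewrite expr2 -lee_fin !EFinM -!level_massE; apply: brunn_minkowski.
- exact: measurable_column_level.
- exact: measurable_column_level.
- exact: measurable_column_level.
move=> s t [s0 cs] [t0 ct]; split => [i k|i]; rewrite complete_mid_array.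
  by rewrite addr_ge0// mulr_ge0.
by rewrite mid lerD// ler_wpM2l.
Qed.

(** Permuting the rows of the minor preserves both the Lebesgue measure and the body. Involutions
    are enough: the symmetry is applied to transpositions. *)
Lemma level_mass_perm c (f : 'I_m -> 'I_m) : involutive f ->
  level_mass (c \o f) = level_mass c.
Proof.
move=> fK; rewrite /level_mass -(power_measure_reindex _ _ _ _ m f f)//; last first.
  exact: measurable_column_level.
congr (fine (mu _)); apply/seteqP; split => t [t0 ct]; split => [i k|i].
- case: (unliftP ord0 i) => [i' ->|->].
    by have := t0 (lift ord0 (f i')) k; rewrite complete_reindex_lift fK.
  by have := t0 ord0 k; rewrite complete_reindex0//; exact: inv_inj.
- by have := ct (f i); rewrite /= fK complete_reindex_lift fK.
- case: (unliftP ord0 i) => [i' ->|->].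
    by rewrite complete_reindex_lift; exact: t0.
  by rewrite complete_reindex0; [exact: t0|exact: inv_inj].
- by rewrite complete_reindex_lift; exact: ct.
Qed.

Definition raise c k (a : R) : 'I_m -> R := fun i => if i == k then a else c i.

(** The column entries are nonnegative with sum 1, so at most [a^-1] of them reach [a]. As [c] is
    nonpositive on [K], changing its value at some [k] in [K] to [a] only shrinks the set. *)
Lemma level_mass_markov c a (K : pred 'I_m) : 0 < a -> (forall k, K k -> c k <= 0) ->
  \sum_(k | K k) level_mass (raise c k a) <= a^-1 * level_mass c.
Proof.
move=> a0 cK; rewrite -lee_fin EFinM -level_massE -sumEFin.
under eq_bigr do rewrite -level_massE.
apply: sum_measure_le => //.
- by move=> k; exact: measurable_column_level.
- exact: measurable_column_level.
- by rewrite invr_ge0 ltW.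
move=> t; have sub k : K k -> column_level (raise c k a) t -> column_level c t.
  move=> Kk [t0 ct]; split => // i; have := ct i; rewrite /raise.
  by case: eqP => // -> _; apply: le_trans (cK _ Kk) (t0 _ _).
have [[t0 ct]|nct] := pselect (column_level c t); last first.
  rewrite big1; first by rewrite mulr_ge0// invr_ge0 ltW.
  by move=> k Kk; rewrite indicE memNset// => /(sub _ Kk).
rewrite [X in _ <= _ * X]indicE mem_set// mulr1.
rewrite -[X in _ <= X]mulr1 ler_pdivlMl// mulr_sumr.
rewrite -(complete_col_sum t j) big_ord_recl.
apply: (@le_trans _ _ (\sum_i complete t (lift ord0 i) j)); last by rewrite lerDr.
rewrite big_mkcond/=; apply: ler_sum => k _; case: ifPn => // Kk.
rewrite indicE; have [|_] := boolP (_ \in _); last by rewrite mulr0.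
by rewrite inE => -[_ /(_ k)]; rewrite /raise eqxx mulr1.
Qed.

End column_levels.

(** * Exponential decay of the joint tails *)

Section tail.
Context {R : realType} {m : nat} (j : 'I_m.+1).
Local Notation mass := (@level_mass R m j).
Local Notation a := (64 / m.+1%:R : R).

(* Log-concavity turns the bound at a into exponential decay: the mass at
   2 * theta is at most (mass at theta)^2 / (mass at 0). *)
Lemma level_mass_dyadic (c : 'I_m -> R) k (b p : R) l : 0 <= p -> 0 < b ->
  mass (raise c k b) <= p * mass (raise c k 0) ->
  mass (raise c k (b * 2 ^+ l)) <= p ^+ (2 ^ l) * mass (raise c k 0).
Proof.
move=> p0 b0 H; have M0 := level_mass_ge0 j (raise c k 0).
elim: l => [|l IH]; first by rewrite expr0 mulr1 expn0 expr1.
have lc : mass (raise c k (b * 2 ^+ l.+1)) * mass (raise c k 0) <=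
    mass (raise c k (b * 2 ^+ l)) ^+ 2.
  apply: level_mass_log_concave => i; rewrite /raise; case: eqP => _.
    by rewrite exprS; field.
  by field.
(* A vanishing mass at 0 could not be cancelled below; in that case monotonicity forces the left
   side to be 0. *)
move: M0; rewrite le_eqVlt => /orP[/eqP M0|M0].
  rewrite -M0 mulr0 M0; apply: level_mass_le => i; rewrite /raise; case: eqP => // _.
  by rewrite mulr_ge0 ?exprn_ge0// ltW.
rewrite -(ler_pM2r M0); apply: (le_trans lc).
apply: (@le_trans _ _ ((p ^+ (2 ^ l) * mass (raise c k 0)) ^+ 2)).
  by rewrite ler_pXn2r// nnegrE ?level_mass_ge0// mulr_ge0 ?exprn_ge0// ltW.
by rewrite exprMn -exprM mulnC -expnS expr2 mulrA.
Qed.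

Definition threshold (S : {set 'I_m}) (b : R) : 'I_m -> R :=
  fun i => if i \in S then b else 0.

Lemma level_mass_raise_sym (S : {set 'I_m}) (b b' : R) k k' : k \notin S -> k' \notin S ->
  mass (raise (threshold S b) k b') = mass (raise (threshold S b) k' b').
Proof.
move=> kS k'S; rewrite -[RHS](level_mass_perm j _ (tperm k k')); last exact: tpermK.
congr (mass _); apply/funext => i; rewrite /raise /threshold /=.
case: tpermP => [->|->|/eqP ik /eqP ik'].
- by rewrite !eqxx.
- by rewrite (eq_sym k k') (negbTE kS) (negbTE k'S).
- by rewrite (negbTE ik) (negbTE ik').
Qed.

Lemma threshold_setU1 (S : {set 'I_m}) k b : k \in S ->
  threshold S b = raise (threshold (S :\ k) b) k b.
Proof.
move=> kS; apply/funext => i; rewrite /threshold /raise !inE.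
by case: eqP => [->|//]; rewrite kS.
Qed.

Lemma raise_threshold0 (S : {set 'I_m}) k b : k \notin S ->
  raise (threshold S b) k 0 = threshold S b.
Proof.
by move=> kS; apply/funext => i; rewrite /threshold /raise; case: eqP => // ->; rewrite (negbTE kS).
Qed.

(** At least [m.+1 / 2] entries, each at least [64 / m.+1], would sum to at least 32, while the
    column sum is 1. *)
Lemma level_mass_threshold_large (S : {set 'I_m}) (b : R) : a <= b -> (m < #|S|.*2)%N ->
  mass (threshold S b) = 0.
Proof.
move=> ab mS; rewrite /level_mass (_ : column_level _ _ = set0) ?measure0//.
apply/seteqP; split => // t [t0 tb].
have : \sum_(i in S) b <= 1.
  rewrite -(complete_col_sum t j) big_ord_recl.
  apply: (@le_trans _ _ (\sum_i complete t (lift ord0 i) j)); last by rewrite lerDr.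
  rewrite big_mkcond/=; apply: ler_sum => i _.
  by have := tb i; rewrite /threshold; case: ifP => // _ _; exact: t0.
apply/negP; rewrite -ltNge sumr_const -mulr_natr.
apply: (@lt_le_trans _ _ (a * #|S|%:R)); last by rewrite ler_wpM2r.
rewrite mulrAC ltr_pdivlMr ?ltr0n// mul1r -natrM ltr_nat.
by move: mS; rewrite -addnn; lia.
Qed.

(** Induction on the size of [S], removing one row [k]. If the remaining rows exceed half of [m],
    the mass is 0. Otherwise Markov's inequality gives a factor [1 / 16] for raising the threshold
    of row [k] to [a], and log-concavity amplifies it to the power [2 ^ l]. *)
Lemma level_mass_tail (S : {set 'I_m}) l :
  mass (threshold S (a * 2 ^+ l)) <=
  (16^-1) ^+ (2 ^ l * #|S|) * fine (lebesgue_array R m (@ds_body R m)).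
Proof.
have a0 : 0 < a by rewrite divr_gt0.
move En : #|S| => n; elim: n S En => [|n IHn] S Sn.
  rewrite muln0 expr0 mul1r level_mass_nonpos// => i.
  by rewrite /threshold (_ : i \in S = false)//; move/eqP: Sn; rewrite cards_eq0 => /eqP ->; rewrite inE.
have [k kS] : exists k, k \in S by apply/set0Pn; rewrite -card_gt0 Sn.
have S'n : #|S :\ k| = n by move: Sn; rewrite (cardsD1 k) kS add1n => -[].
have kS' : k \notin S :\ k by rewrite !inE eqxx.
have [big|small] := ltnP m (#|S :\ k|.*2).
  rewrite level_mass_threshold_large ?mulr_ge0 ?exprn_ge0 ?fine_ge0//.
    by rewrite ler_peMr; [|exact: ltW|rewrite exprn_ege1// ler1n].
  by rewrite (leq_trans big)// leq_double subset_leq_card// subD1set.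
rewrite (threshold_setU1 _ _ _ kS).
set b := a * 2 ^+ l; set c := threshold (S :\ k) b.
(* The rows outside S :\ k are exchangeable and their entries sum to at most 1. *)
have step : mass (raise c k a) <= 16^-1 * mass (raise c k 0).
  rewrite raise_threshold0//.
  have := level_mass_markov j c a (fun i => i \notin S :\ k) a0.
  rewrite (eq_bigr (fun=> mass (raise c k a))); last first.
    by move=> i iS; exact: level_mass_raise_sym.
  rewrite sumr_const => Hm; move: (Hm); have {Hm} /[swap]/[apply] : forall i, i \notin S :\ k -> c i <= 0.
    by move=> i iS; rewrite /c /threshold (negbTE iS).
  have -> : #|[pred i | i \notin S :\ k]| = (m - n)%N.
    by apply/eqP; rewrite -(eqn_add2l n) -{1}S'n (cardC (mem (S :\ k))) card_ord
      subnKC// -[X in (_ <= X)%N](card_ord m) -S'n max_card.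
  rewrite S'n in small; rewrite invf_div -[_ *+ (m - n)]mulr_natr.
  have Mc0 := level_mass_ge0 j c; have Mr0 := level_mass_ge0 j (raise c k a).
  (* At least half of the rows remain, and [m] is positive because [k] exists, so
     [m.+1 <= 2 * m <= 4 * (m - n)]. The constant 64 is this 4 times the 16 to be gained. *)
  have n1 : (m.+1 <= 4 * (m - n))%N.
    by have := leq_ltn_trans (leq0n k) (ltn_ord k); move: small; rewrite -addnn; lia.
  have : m.+1%:R <= 4 * (m - n)%:R :> R by rewrite -natrM ler_nat.
  set u := m.+1%:R; set v := (m - n)%:R; have u0 : 0 < u by rewrite ltr0n.
  move: Mr0; set x := mass (raise c k a); set y := mass c => x0 uv Hm.
  have xuv := ler_wpM2l x0 uv.
  by rewrite -(ler_pM2l u0); lra.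
apply: (le_trans (level_mass_dyadic c k a _ l _ a0 step)) => //.
rewrite raise_threshold0// mulnS exprD -mulrA ler_wpM2l ?exprn_ge0//.
exact: IHn.
Qed.

End tail.

(** * The union bound *)

Section binomial_tail.
Context {R : realType}.

(** From [1 - 1/2 <= expR (- 1/2)] follows [expR (1/2) <= 2], which is then squared. *)
Lemma expR1_le4 : expR 1 <= 4 :> R.
Proof.
have := expR_ge1Dx (- 2^-1 : R); rewrite expRN => h.
have e0 : 0 < expR 2^-1 :> R := expR_gt0 _.
have e2 : expR 2^-1 <= 2 :> R.
  by have := ler_wpM2l (ltW e0) h; rewrite mulfV ?gt_eqF//; lra.
have -> : expR 1 = expR 2^-1 * expR 2^-1 :> R by rewrite -expRD; congr expR; field.
nra.
Qed.

(** For [r <= n] the left side is a single term of the binomial expansion. *)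
Lemma bin_expr_le (n r : nat) (x : R) : 0 <= x -> 'C(n, r)%:R * x ^+ r <= (1 + x) ^+ n.
Proof.
move=> x0; have [nr|rn] := ltnP n r.
  by rewrite bin_small// mul0r exprn_ge0// addr_ge0.
rewrite exprDn (bigD1 (inord r))//= inordK// expr1n mul1r mulr_natl lerDl.
by apply: sumr_ge0 => i _; rewrite mulrn_wge0// mulr_ge0// exprn_ge0.
Qed.

Lemma exprV_le_expRN (b : R) (q : nat) : 4 <= b -> b^-1 ^+ q <= expR (- q%:R).
Proof.
move=> b4; have b0 : 0 < b by apply: lt_le_trans b4.
rewrite expRN exprVn lef_pV2 ?posrE ?expR_gt0 ?exprn_gt0//.
rewrite -[q%:R]mul1r expRM_natr.
by apply: lerXn2r; rewrite ?nnegrE ?expR_ge0 ?(ltW b0)// (le_trans expR1_le4).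
Qed.

(* With x = 1 / q^2, bound 'C(n, r) x^r by exp (n x) and q^2 / 16^q by exp (- q). *)
Lemma bin_exp16_le (n r q : nat) (s : R) : (0 < q)%N ->
  n%:R / q%:R ^+ 2 + s <= q%:R * r%:R ->
  'C(n, r)%:R * 16^-1 ^+ (q * r) <= expR (- s) :> R.
Proof.
move=> q0 nsr; have q0R : 0 < q%:R :> R by rewrite ltr0n.
set x : R := (q%:R ^+ 2)^-1; have x0 : 0 <= x by rewrite invr_ge0 exprn_ge0.
(* Split 16 as 4 times 4: one factor [4 ^+ q] dominates [q ^ 2], because [q < 2 ^ q], and the other
   dominates [expR q]. *)
have xq : 16^-1 ^+ q <= x * expR (- q%:R).
  have h : q%:R ^+ 2 <= 4 ^+ q :> R.
    rewrite -[4](_ : 2 ^+ 2 = _); last by rewrite expr2 -natrM.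
    rewrite exprAC; apply: lerXn2r; rewrite ?nnegrE// -natrX ler_nat.
    exact/ltnW/ltn_expl.
  have h4 : 4^-1 ^+ q <= expR (- q%:R) :> R by exact: exprV_le_expRN.
  rewrite (_ : 16^-1 = 4^-1 * 4^-1 :> R); last by field.
  rewrite exprMn; apply: ler_pM => //; rewrite ?exprn_ge0//.
  by rewrite exprVn lef_pV2 ?posrE ?exprn_gt0.
have -> : - s = n%:R * x - q%:R * r%:R + (q%:R * r%:R - n%:R / q%:R ^+ 2 - s).
  by rewrite /x; ring.
apply: (@le_trans _ _ ((1 + x) ^+ n * expR (- q%:R) ^+ r)).
  apply: (@le_trans _ _ ('C(n, r)%:R * (x * expR (- q%:R)) ^+ r)).
    by rewrite exprM ler_wpM2l// lerXn2r// nnegrE ?exprn_ge0// mulr_ge0// expR_ge0.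
  by rewrite exprMn mulrA ler_wpM2r ?exprn_ge0 ?expR_ge0// bin_expr_le.
apply: (@le_trans _ _ (expR (n%:R * x - q%:R * r%:R))).
  rewrite expRD; apply: ler_pM; rewrite ?exprn_ge0 ?expR_ge0 ?addr_ge0//.
    by rewrite mulrC expRM_natr lerXn2r ?nnegrE ?expR_ge0 ?addr_ge0// expR_ge1Dx.
  by rewrite -mulNr expRM_natr.
by rewrite ler_expR lerDl; lra.
Qed.

End binomial_tail.

(** * Dyadic decomposition of sums of squares *)

Section dyadic_sum.
Context {R : realType}.

(** If [y] lies between [a * 2 ^+ l] and [a * 2 ^+ l.+1], the term of index [l] alone exceeds
    [y ^+ 2]; below [a] the summand [a ^+ 2] suffices. *)
Lemma sqr_dyadic_le (a y : R) L : 0 < a -> 0 <= y -> y < a * 2 ^+ L ->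
  y ^+ 2 <= a ^+ 2 + \sum_(l < L) 4 * a ^+ 2 * 4 ^+ l * (a * 2 ^+ l <= y)%R%:R.
Proof.
move=> a0 y0; elim: L => [|L IH].
  by rewrite big_ord0 addr0 expr0 mulr1 => ya; rewrite lerXn2r ?nnegrE// ltW.
rewrite big_ord_recr/= => ya; have [yL|yL] := ltP y (a * 2 ^+ L).
  by rewrite mulr0 addr0; exact: IH.
rewrite mulr1; apply: (@le_trans _ _ (4 * a ^+ 2 * 4 ^+ L)).
  have -> : 4 * a ^+ 2 * 4 ^+ L = (a * 2 ^+ L.+1) ^+ 2.
    rewrite exprMn exprAC (_ : 2 ^+ 2 = 4 :> R); last by rewrite expr2 -natrM.
    by rewrite [4 ^+ L.+1]exprS; ring.
  by rewrite lerXn2r ?nnegrE ?mulr_ge0 ?exprn_ge0// ltW.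
by rewrite addrA lerDr addr_ge0 ?sqr_ge0// sumr_ge0// => l _; rewrite !mulr_ge0 ?exprn_ge0// ltW.
Qed.

(** Exchanging sums, level [l] contributes [4 * a ^+ 2] times [4 ^+ l] times its count, where the
    last two factors give at most [u l = m / 2 ^+ l + s * 2 ^+ l]. The geometric sums add up to at
    most [2 * m + s * 2 ^+ L], and 9 is [1 + 4 * 2]. *)
Lemma sum_sqr_dyadic_le (m : nat) (y : 'I_m -> R) (a s : R) L : 0 < a ->
  (forall i, 0 <= y i < a * 2 ^+ L) ->
  (forall l : 'I_L, 2 ^+ l * #|[set i | (a * 2 ^+ l <= y i)%R]%SET|%:R <= m%:R / 4 ^+ l + s) ->
  0 <= s -> \sum_i y i ^+ 2 <= 9 * a ^+ 2 * m%:R + 4 * a ^+ 2 * s * 2 ^+ L.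
Proof.
move=> a0 yL cnt s0.
pose u l : R := m%:R / 2 ^+ l + s * 2 ^+ l.
have sumu K : \sum_(l < K) u l <= m%:R * (2 - 2 / 2 ^+ K) + s * (2 ^+ K - 1).
  elim: K => [|K IH]; first by rewrite big_ord0 expr0; lra.
  rewrite big_ord_recr/=; apply: (le_trans (lerD IH (lexx _))); rewrite /u exprS.
  by rewrite le_eqVlt; apply/orP; left; apply/eqP; field; rewrite expf_neq0.
apply: (@le_trans _ _ (\sum_(i < m) (a ^+ 2 +
    \sum_(l < L) 4 * a ^+ 2 * 4 ^+ l * (a * 2 ^+ l <= y i)%R%:R))).
  by apply: ler_sum => i _; have /andP[y0 y1] := yL i; exact: sqr_dyadic_le.
rewrite big_split/= sumr_const card_ord exchange_big/=.
have : \sum_(l < L) \sum_(i < m) 4 * a ^+ 2 * 4 ^+ l * (a * 2 ^+ l <= y i)%R%:R <=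
    \sum_(l < L) 4 * a ^+ 2 * u l.
  apply: ler_sum => l _; rewrite -mulr_sumr -mulrA; apply: ler_wpM2l.
    by rewrite mulr_ge0// sqr_ge0.
  have -> : \sum_(i < m) (a * 2 ^+ l <= y i)%R%:R = #|[set i | (a * 2 ^+ l <= y i)%R]%SET|%:R :> R.
    rewrite -sum1_card natr_sum [RHS]big_mkcond/=; apply: eq_bigr => i _.
    by rewrite inE; case: ifP.
  have E4 : 4 ^+ l = 2 ^+ l * 2 ^+ l :> R.
    by rewrite -exprMn -natrM.
  have l0 : 0 < 2 ^+ l :> R by rewrite exprn_gt0.
  rewrite E4 -mulrA; apply: (le_trans (ler_wpM2l (ltW l0) (cnt l))).
  by rewrite E4 /u le_eqVlt; apply/orP; left; apply/eqP; field; rewrite gt_eqF.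
rewrite -mulr_sumr -[_ *+ m]mulr_natr.
have sumuL : \sum_(l < L) u l <= m%:R * 2 + s * 2 ^+ L.
  apply: (le_trans (sumu L)); apply: lerD; apply: ler_wpM2l => //.
    by rewrite gerBl mulr_ge0// invr_ge0 exprn_ge0.
  by rewrite gerBl.
have a20 : 0 <= 4 * a ^+ 2 by rewrite mulr_ge0// sqr_ge0.
by have := ler_wpM2l a20 sumuL; lra.
Qed.

End dyadic_sum.

Lemma measurable_exists2 d (T : measurableType d) (I : finType) (P : pred I)
    (A : I -> set T) : (forall i, measurable (A i)) ->
  measurable [set t | exists2 i, P i & A i t].
Proof.
move=> mA; rewrite (_ : mkset _ = \bigcup_(i in [set i | P i]) A i); last first.
  by apply/seteqP; split => t [i Pi At]; exists i.
exact: fin_bigcup_measurable.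
Qed.

Lemma measure_exists2_le d (T : measurableType d) (R : realType) (I : finType)
    (mu : {measure set T -> \bar R}) (P : pred I) (A : I -> set T) :
  (forall i, measurable (A i)) ->
  (mu [set t | exists2 i, P i & A i t] <= \sum_(i | P i) mu (A i))%E.
Proof.
move=> mA; rewrite (_ : mkset _ = \big[setU/set0]_(i | P i) A i); last first.
  rewrite -bigcup_seq_cond; apply/seteqP; split => t [i /= Pi At]; exists i => //=.
    by rewrite mem_index_enum.
  by case/andP: Pi.
pose Q (x : \bar R) (B : set T) := measurable B /\ (mu B <= x)%E.
suff [] : Q (\sum_(i | P i) mu (A i))%E (\big[setU/set0]_(i | P i) A i) by [].
apply: big_ind2 => [|x B y C [mB xB] [mC yC]|i _]; rewrite /Q ?measure0//.
split; first exact: measurableU.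
by apply: (le_trans (measureU2 mu mB mC)); exact: leeD.
Qed.

Section union_bound.
Context {R : realType} {m : nat}.
Local Notation mu := (lebesgue_array R m).
Local Notation V := (fine (mu (@ds_body R m))).
Local Notation a := (64 / m.+1%:R : R).

(** The exceptional event of the union bound. Sets of exactly [r l] rows suffice, since a larger set
    of large entries contains one, and their number is a binomial coefficient. *)
Definition many_large (L : nat) (r : nat -> nat) : set (array R m) :=
  [set t | exists2 p : 'I_m.+1 * 'I_L.+1 * {set 'I_m}, #|p.2| == r p.1.2 &
    column_level p.1.1 (threshold p.2 (a * 2 ^+ p.1.2)) t].

Lemma measurable_many_large L r : measurable (many_large L r).
Proof. by apply: measurable_exists2 => p; exact: measurable_column_level. Qed.

(** Each of the [m.+1 * L.+1] pairs of a column and a level contributes ['C(m, r l)] sets of rows,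
    each bounded by [level_mass_tail]. *)
Lemma lebesgue_many_large_le L (r : nat -> nat) (e : R) :
  (forall l : 'I_L.+1, 'C(m, r l)%:R * 16^-1 ^+ (2 ^ l * r l) <= e) ->
  (mu (many_large L r) <= (m.+1%:R * L.+1%:R * e * V)%:E)%E.
Proof.
move=> re; apply: (le_trans (measure_exists2_le _ _ _ _ mu _ _ _)).
  by move=> p; exact: measurable_column_level.
rewrite (eq_bigr (fun p : 'I_m.+1 * 'I_L.+1 * {set 'I_m} =>
    (level_mass p.1.1 (threshold p.2 (a * 2 ^+ p.1.2)))%:E)); last first.
  by move=> p _; exact: level_massE.
rewrite sumEFin lee_fin.
rewrite -(pair_big_dep xpredT (fun (q : 'I_m.+1 * 'I_L.+1) (S : {set 'I_m}) => #|S| == r q.2)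
  (fun q (S : {set 'I_m}) => level_mass q.1 (threshold S (a * 2 ^+ q.2))))/=.
apply: (@le_trans _ _ (\sum_(q : 'I_m.+1 * 'I_L.+1) e * V)); last first.
  by rewrite sumr_const -[X in X <= _]mulr_natl card_prod !card_ord natrM mulrA.
apply: ler_sum => -[j l] _ /=.
apply: (@le_trans _ _ (\sum_(S : {set 'I_m} | #|S| == r l) 16^-1 ^+ (2 ^ l * r l) * V)).
  by apply: ler_sum => S /eqP <-; exact: level_mass_tail.
rewrite sumr_const -[X in X <= _]mulr_natl mulrA ler_wpM2r ?fine_ge0//.
apply: le_trans (re l); rewrite ler_wpM2r ?exprn_ge0//.
rewrite ler_nat -[X in 'C(X, _)](card_ord m) -card_draws.
by apply: eq_leq; apply: eq_card => S; rewrite !inE.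
Qed.

End union_bound.

Lemma exists_expr2 {R : realType} (s : R) : 1 <= s -> exists L, s <= 2 ^+ L <= 2 * s.
Proof.
move=> s1; have : exists L, s <= 2 ^+ L.
  exists (Num.bound s); apply: (le_trans (ltW (archi_boundP _))); first exact: le_trans s1.
  by rewrite -natrX ler_nat ltnW// ltn_expl.
move/ex_minnP => [[|L] sL Lmin]; first by exists 0%N; rewrite sL expr0; lra.
exists L.+1; rewrite sL exprS ler_pM2l//= leNgt; apply/negP => Ls.
by have := Lmin L (ltW Ls); rewrite ltnn.
Qed.

(** * Sums of squares off the exceptional event, and the final estimate *)

Section spread.
Context {R : realType}.
Local Notation C0 := (17 * 64 ^+ 2 : R).

(** Off the exceptional event fewer than [r l] entries reach level [l], so the dyadic bound applies.
    It gives [a ^+ 2 * (9 * m + 4 * s * 2 ^+ L)], at most [17 * a ^+ 2 * n] because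
    [s * 2 ^+ L <= 2 * s ^+ 2 = 2 * n]. *)
Lemma column_sqr_sum_le m (t : array R m) (L : nat) (r : nat -> nat) (s : R) (j : 'I_m.+1) :
    s ^+ 2 = m.+1%:R -> 0 <= s -> 2 ^+ L <= 2 * s -> r L = 1%N ->
    (forall l N, (l < L)%N -> (N < r l)%N -> 2 ^+ l * N%:R <= m%:R / 4 ^+ l + s) ->
    (forall i k, 0 <= complete t i k) -> ~ many_large L r t ->
  \sum_i complete t (lift ord0 i) j ^+ 2 <= C0 / m.+1%:R.
Proof.
move=> sE s0 L2s rL rP t0 nbad; set n : R := m.+1%:R; have n0 : 0 < n by rewrite ltr0n.
set a := 64 / n; have a0 : 0 < a by rewrite divr_gt0.
have small (l : 'I_L.+1) (S : {set 'I_m}) :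
    (forall i, i \in S -> a * 2 ^+ l <= complete t (lift ord0 i) j) -> #|S| != r l.
  move=> Sl; apply/negP => /eqP Sr; apply: nbad.
  exists (j, l, S) => /=; first exact/eqP.
  by split => // i; rewrite /threshold; case: ifP => // iS; exact: Sl.
apply: (le_trans (sum_sqr_dyadic_le m (fun i => complete t (lift ord0 i) j) a s L a0 _ _ s0)).
(* As [r L = 1], a single entry reaching the top level would already be exceptional. *)
- move=> i; rewrite t0/= ltNge; apply/negP => ai.
  have := small ord_max [set i]%SET; rewrite cards1 rL eqxx => /(_ _)/negP; apply => //.
  by move=> k; rewrite inE => /eqP ->.
- move=> l; apply: rP => //; rewrite ltnNge; apply/negP => rle.
  set B := [set i | _]%SET in rle.
  (* Too many large entries would contain a set of exactly [r l] of them, cut from their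
     enumeration. *)
  have := small (widen_ord (leqnSn L) l) [set i in take (r l) (enum B)]%SET.
  rewrite cardsE (card_uniqP _) ?take_uniq ?enum_uniq//= size_takel -?cardE// eqxx.
  move=> /(_ _)/negP; apply => // i; rewrite inE => /mem_take.
  by rewrite mem_enum inE.
have -> : 9 * a ^+ 2 * m%:R + 4 * a ^+ 2 * s * 2 ^+ L =
  a ^+ 2 * (9 * m%:R + 4 * (s * 2 ^+ L)) by ring.
have -> : C0 / n = a ^+ 2 * (17 * n) by rewrite /a; field; rewrite gt_eqF.
apply: ler_wpM2l; first exact: sqr_ge0.
have : s * 2 ^+ L <= 2 * n by rewrite /n -sE expr2 mulrCA ler_wpM2l.
have : m%:R <= n by rewrite ler_nat.
lra.
Qed.

(** The added 1 leaves room for the strict inequality of [spread_sum_lt]. *)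
Definition spread m : set 'M[R]_m.+1 := [set X | 2 * C0 + 1 <=
  \sum_(i | i != ord0) \sum_(j | j != ord0) (X i j - X i ord0) ^+ 2].

Lemma sum_neq0 m (F : 'I_m.+1 -> R) :
  \sum_(i | i != ord0) F i = \sum_(i < m) F (lift ord0 i).
Proof. by rewrite big_mkcond big_ord_recl/= add0r. Qed.

(** For nonnegative entries the square of a difference is at most the sum of the squares. Each of
    [m] columns, paired with column [ord0], thus costs at most [2 * (c / m.+1)]. *)
Lemma spread_sum_lt m (X : 'M[R]_m.+1) (c : R) : 0 <= c -> (forall i j, 0 <= X i j) ->
    (forall j, \sum_i X (lift ord0 i) j ^+ 2 <= c / m.+1%:R) ->
  \sum_(i | i != ord0) \sum_(j | j != ord0) (X i j - X i ord0) ^+ 2 < 2 * c + 1.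
Proof.
move=> c0 X0 col; rewrite sum_neq0; under eq_bigr do rewrite sum_neq0.
rewrite exchange_big/=.
apply: (@le_lt_trans _ _ (\sum_(j < m) (2 * (c / m.+1%:R)))).
  apply: ler_sum => j _.
  apply: (@le_trans _ _ (\sum_(i < m) (X (lift ord0 i) (lift ord0 j) ^+ 2 +
      X (lift ord0 i) ord0 ^+ 2))).
    apply: ler_sum => i _.
    by rewrite sqrrB lerD2r gerBl mulrn_wge0// mulr_ge0.
  by rewrite big_split/= mulr_natl mulr2n; apply: lerD; exact: col.
rewrite sumr_const card_ord -[_ *+ m]mulr_natr.
apply: (@le_lt_trans _ _ (2 * c)); last by rewrite ltrDl.
by rewrite -mulrA ler_wpM2l// mulrAC ler_pdivrMr ?ltr0n// ler_wpM2l// ler_nat.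
Qed.

Lemma spread_many_large m (t : array R m) (L : nat) (r : nat -> nat) (s : R) :
    s ^+ 2 = m.+1%:R -> 0 <= s -> 2 ^+ L <= 2 * s -> r L = 1%N ->
    (forall l N, (l < L)%N -> (N < r l)%N -> 2 ^+ l * N%:R <= m%:R / 4 ^+ l + s) ->
    (forall i k, 0 <= complete t i k) -> spread m (complete t) ->
  many_large L r t.
Proof.
move=> sE s0 L2s rL rP t0 spr; apply: contrapT => nbad.
have c0 : 0 <= C0 by rewrite mulr_ge0// exprn_ge0.
have := spread_sum_lt m _ _ c0 t0
  (fun j => column_sqr_sum_le m t L r s j sE s0 L2s rL rP t0 nbad).
by apply/negP; rewrite -leNgt.
Qed.

Lemma measurable_spread m : measurable [set t : array R m | spread m (complete t)].
Proof.
pose f (t : array R m) := \sum_i \sum_j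
  (complete t (lift ord0 i) (lift ord0 j) - complete t (lift ord0 i) ord0) ^+ 2.
have mf : measurable_fun setT f.
  apply: measurable_sum => i; apply: measurable_sum => j; apply: measurable_funX.
  by apply: measurable_funB; exact: measurable_complete.
rewrite (_ : mkset _ = setT `&` f @^-1` `[2 * C0 + 1, +oo[%classic).
  by apply: mf => //; exact: measurable_itv.
rewrite setTI; apply/seteqP; split => t /=; rewrite /spread/= in_itv/= andbT sum_neq0;
  by under eq_bigr do rewrite sum_neq0.
Qed.

Lemma ds_prob_spread_le m : (0 < m)%N ->
  ds_prob (spread m) <=
  2 * m.+1%:R ^+ 3 * expR (- Num.sqrt m.+1%:R).
Proof.
move=> m0; set s : R := Num.sqrt m.+1%:R; set n : R := m.+1%:R.
have n0 : 0 < n by rewrite ltr0n.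
have sE : s ^+ 2 = n by rewrite sqr_sqrtr// ltW.
have s1 : 1 <= s by rewrite -[1]sqrtr1 ler_sqrt// ler1n.
have s0 : 0 <= s by exact: le_trans s1.
(* The top level is about [sqrt n]: high enough that one entry there has probability at most
   [expR (- s)], low enough to keep [s * 2 ^+ L] of order [n]. *)
have [L /andP[sL L2s]] := exists_expr2 s s1.
have exr l : exists N, m%:R / (2 ^ l)%:R ^+ 2 + s <= (2 ^ l)%:R * N%:R :> R.
  have pos : 0 <= m%:R / (2 ^ l)%:R ^+ 2 + s by rewrite addr_ge0// divr_ge0.
  exists (Num.bound (m%:R / (2 ^ l)%:R ^+ 2 + s)); apply: (le_trans (ltW (archi_boundP pos))).
  by rewrite ler_peMl// ler1n expn_gt0.
(* Minimality serves twice: [r l] meets the condition of [bin_exp16_le], while every smaller count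
   violates it and so obeys the bound [rP]. *)
pose r l := if (l < L)%N then ex_minn (exr l) else 1%N.
have rL : r L = 1%N by rewrite /r ltnn.
have rP l N : (l < L)%N -> (N < r l)%N -> 2 ^+ l * N%:R <= m%:R / 4 ^+ l + s.
  rewrite /r => ->; case: ex_minnP => k _ kmin Nk.
  have := contraNN (kmin N); rewrite -ltnNge -ltNge => /(_ Nk)/ltW.
  by rewrite natrX exprAC (_ : 2 ^+ 2 = 4 :> R)// expr2 -natrM.
have rbin (l : 'I_L.+1) : 'C(m, r l)%:R * 16^-1 ^+ (2 ^ l * r l) <= n * expR (- s).
  have [lL|lL] := ltnP l L.
    apply: (@le_trans _ _ (expR (- s))); last by rewrite ler_peMl ?expR_ge0// ler1n.
    apply: bin_exp16_le; first by rewrite expn_gt0.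
    by rewrite /r lL; case: ex_minnP.
  have -> : nat_of_ord l = L by apply/eqP; rewrite eqn_leq lL -ltnS ltn_ord.
  (* At the top level the union is over [m] single rows, and [s <= 2 ^+ L] gives the exponential. *)
  rewrite rL bin1 muln1; apply: ler_pM; rewrite ?exprn_ge0// ?ler_nat//.
  apply: (le_trans (exprV_le_expRN 16 (2 ^ L) _)); first by rewrite ler_nat.
  by rewrite ler_expR lerN2 natrX.
pose E : set (array R m) :=
  [set t | (forall i k, 0 <= complete t i k) /\ spread m (complete t)].
have sub : E `<=` many_large L r.
  by move=> t [t0 spr]; exact: (spread_many_large m t L r s).
rewrite /ds_prob image_minor_array -/E.
(* For a body of volume 0 the quotient is 0, since the inverse of 0 is 0. *)
have [V0|V0] := eqVneq (fine (lebesgue_array R m (ds_body (R := R) (m := m)))) 0.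
  by rewrite V0 invr0 mulr0 mulr_ge0 ?expR_ge0// mulr_ge0// exprn_ge0// ltW.
have Vpos : 0 < fine (lebesgue_array R m (ds_body (R := R) (m := m))).
  by rewrite lt_neqAle eq_sym V0 fine_ge0.
rewrite ler_pdivrMr// -lee_fin.
have mE : measurable E.
  rewrite (_ : E = ds_body (R := R) (m := m) `&` [set t | spread m (complete t)]).
    by apply: measurableI; [exact: measurable_ds_body|exact: measurable_spread].
  by rewrite /E ds_bodyE.
have le1 : (lebesgue_array R m E <=
   (n * L.+1%:R * (n * expR (- s)) * fine (lebesgue_array R m (ds_body (R := R) (m := m))))%:E)%E.
  apply: le_trans (lebesgue_many_large_le L r _ rbin).
  by apply: le_measure; rewrite ?inE//; exact: measurable_many_large.
rewrite fineK; last by rewrite ge0_fin_numE// (le_lt_trans le1)// ltry.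
apply: (le_trans le1); rewrite lee_fin; apply: ler_wpM2r; first exact: ltW.
(* The chain is [L.+1 <= 2 ^ L <= 2 * s <= 2 * n]. *)
have Ln : L.+1%:R <= 2 * n.
  apply: (@le_trans _ _ (2 ^+ L)); first by rewrite -natrX ler_nat ltn_expl.
  apply: (le_trans L2s); apply: ler_wpM2l => //.
  by rewrite -sE expr2; apply: ler_peMl.
rewrite mulrA; apply: ler_wpM2r; first exact: expR_ge0.
have -> : 2 * n ^+ 3 = n * (2 * n) * n by ring.
by apply: ler_wpM2r; [exact: ltW|apply: ler_wpM2l => //; exact: ltW].
Qed.

(** The sixth power of [x / 12 <= expR (x / 12)]. With [x = sqrt n] it absorbs the factor [n ^ 3] of
    the union bound. *)
Lemma expr6_le_expR (x : R) : 0 <= x -> x ^+ 6 <= 12 ^+ 6 * expR (x / 2).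
Proof.
move=> x0; rewrite -ler_pdivrMl ?exprn_gt0// -exprVn -exprMn.
have -> : x / 2 = (x / 12) * 6%:R by field.
rewrite expRM_natr; apply: lerXn2r; rewrite ?nnegrE ?expR_ge0 ?mulr_ge0//.
by rewrite mulrC; apply: le_trans (expR_ge1Dx _); rewrite lerDr.
Qed.

End spread.

(* The n of the usual formulation is m.+1; i and j range over 2, ..., n. *)
Theorem theorem1p9 (R : realType) :
  exists C c : R, [/\ 0 < C, 0 < c &
    (fun m : nat => @ds_prob R m [set X : 'M[R]_m.+1 | C <=
       \sum_(i | i != ord0) \sum_(j | j != ord0) (X i j - X i ord0) ^+ 2]) =O_\oo
    (fun m : nat => expR (- c * Num.sqrt m.+1%:R) : R)].
Proof.
(* The first witness is the constant of [spread]. The exponent drops from 1 to 1/2 because half of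
   it pays for the polynomial factor. *)
exists (2 * (17 * 64 ^+ 2) + 1), 2^-1; split => //.
apply/eqOP; exists (2 * 12 ^+ 6); split; first by [].
move=> k kK; near=> m.
have m0 : (0 < m)%N by near: m; exists 1%N.
have n0 : 0 <= m.+1%:R :> R by [].
have P0 : 0 <= ds_prob (spread (R := R) m) by rewrite divr_ge0// fine_ge0.
rewrite ger0_norm// ger0_norm ?expR_ge0//.
apply: (le_trans (ds_prob_spread_le m m0)).
apply: (@le_trans _ _ (2 * 12 ^+ 6 * expR (- 2^-1 * Num.sqrt m.+1%:R))); last first.
  by rewrite ler_wpM2r ?expR_ge0// ltW.
have := expr6_le_expR _ (sqrtr_ge0 (m.+1%:R : R)).
set s := Num.sqrt _.
have -> : m.+1%:R ^+ 3 = s ^+ 6 by rewrite (_ : 6 = 2 * 3)%N// exprM sqr_sqrtr.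
move=> s6; rewrite -[leLHS]mulrA -[leRHS]mulrA ler_pM2l//.
have -> : expR (- 2^-1 * s) = expR (s / 2) * expR (- s) by rewrite -expRD; congr expR; field.
by rewrite mulrA; apply: ler_wpM2r => //; exact: expR_ge0.
Unshelve. all: by end_near.
Qed.
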